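(* Let $G$ be a group, $(H,\boldsymbol g)$ a finite type pivotal Hopf $G$-coalgebra over a field $\Bbbk$, $\boldsymbol\alpha$ the modulus of $H_1$, and $\nu\in H_1^*$ a group-like functional. The endocategory $(H\text{-pmod},R(\nu)_* )$ has a non-zero right module trace if and only if $\nu=\boldsymbol\alpha$. Similarly, $(H\text{-pmod},L(\nu)_* )$ has a non-zero left module trace if and only if $\nu=\boldsymbol\alpha$. In both cases, the (non-zero) module traces are non-degenerate. In particular, $H$-pmod has a non-zero right (respectively left) modified trace if and only if $H_1$ is unimodular.
   Context: A Hopf $G$-coalgebra is a family of $\Bbbk$-algebras $\{(H_x,m_x,1_x)\}_{x\in G}$ with algebra maps $\Delta_{x,y}\colon H_{xy}\to H_x\otimes H_y$ and $\varepsilon\colon H_1\to\Bbbk$ and linear maps $S_x\colon H_x\to H_{x^{-1}}$ such that $(\Delta_{x,y}\otimes\mathrm{id})\Delta_{xy,z}=(\mathrm{id}\otimes\Delta_{y,z})\Delta_{x,yz}$, $(\mathrm{id}\otimes\varepsilon)\Delta_{x,1}=\mathrm{id}_{H_x}=(\varepsilon\otimes\mathrm{id})\Delta_{1,x}$, and $m_x(S_{x^{-1}}\otimes\mathrm{id})\Delta_{x^{-1},x}=1_x\varepsilon=m_x(\mathrm{id}\otimes S_{x^{-1}})\Delta_{x,x^{-1}}$. It is of finite type if every $H_x$ is finite-dimensional. $H_1$ is a Hopf algebra. It is pivotal with pivot $\boldsymbol g=(\boldsymbol g_x)\in\prod_x H_x$ if $\Delta_{x,y}(\boldsymbol g_{xy})=\boldsymbol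 g_x\otimes\boldsymbol g_y$, $\varepsilon(\boldsymbol g_1)=1$ and $S_{x^{-1}}S_x(a)=\boldsymbol g_x a\boldsymbol g_x^{-1}$ for all $a\in H_x$. $H$-mod is the $G$-graded category $\bigoplus_x H_x\text{-mod}$ (finite-dimensional left modules; objects are finite direct sums of $H_x$-modules for various $x$, with no nonzero morphisms between different degrees). For $V\in H_x$-mod, $W\in H_y$-mod, $V\otimes W$ is an $H_{xy}$-module via $\Delta_{x,y}$. $H$-pmod is the full subcategory of projective objects. For $V\in H_x$-mod, $V^*$ is an $H_{x^{-1}}$-module via $(h\xi)(v)=\xi(S_{x^{-1}}(h)v)$, and $\mathrm{ev}_V(\xi\otimes v)=\xi(v)$, $\mathrm{coev}_V(1)=\sum v_i\otimes v_i^*$, $\widetilde{\mathrm{ev}}_V(v\otimes\xi)=\xi(\boldsymbol g_xv)$, $\widetilde{\mathrm{coev}}_V(1)=\sum v_i^*\otimes\boldsymbol g_x^{-1}v_i$ for a basis $\{v_i\}$. Modulus: if $\boldsymbol c\in H_1$ is a nonzero left cointegral ($a\boldsymbol c=\varepsilon(a)\boldsymbol c$), then $\boldsymbol\alpha\in H_1^*$ is the group-like functional (algebra map) with $\boldsymbol c a=\boldsymbol\alpha(a)\boldsymbol c$ for all $a\in H_1$. $H_1$ is unimodular if $\boldsymbol\alpha=\varepsilon$. For group-like $\nu\in H_1^*$ (i.e. an algebra map $H_1\to\Bbbk$) define algebra automorphisms of each $H_x$: $R(\nu)=(\nu\otimes\mathrm{id})\Delta_{1,x}$ and $L(\nu)=(\mathrm{id}\otimes\nu)\Delta_{x,1}$.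 For a family of algebra automorphisms $\varphi_x$ of $H_x$, the twist functor $\varphi_*$ sends an $H_x$-module $V$ to the same vector space with action $a\cdot_\varphi v=\varphi_x(a)v$, and is the identity on morphisms. $R(\nu)_*$ is a right module endofunctor ($R(\nu)_*(P\otimes V)=R(\nu)_*(P)\otimes V$) and $L(\nu)_*$ a left one ($L(\nu)_*(V\otimes P)=V\otimes L(\nu)_*(P)$), with identity structure maps. A right module trace on $(H\text{-pmod},\Sigma)$ with $\Sigma=R(\nu)_*$ is a family of linear maps $\{\mathsf t_P\colon\mathrm{Hom}_H(P,\Sigma P)\to\Bbbk\}_{P\in H\text{-pmod}}$ with (1) $\mathsf t_P(f\circ g)=\mathsf t_{P'}(\Sigma(g)\circ f)$ for all $g\colon P\to P'$, $f\colon P'\to\Sigma P$; (2) $\mathsf t_{P\otimes V}(f)=\mathsf t_P\bigl((\mathrm{id}\otimes\widetilde{\mathrm{ev}}_V)(f\otimes\mathrm{id}_{V^*})(\mathrm{id}_P\otimes\mathrm{coev}_V)\bigr)$ for all $P\in H$-pmod, $V\in H$-mod, $f\colon P\otimes V\to\Sigma(P\otimes V)=\Sigma(P)\otimes V$. A left module trace (with $\Sigma=L(\nu)_*$) satisfies (1) and instead $\mathsf t_{V\otimes P}(f)=\mathsf t_P\bigl((\mathrm{ev}_V\otimes\mathrm{id})(\mathrm{id}_{V^*}\otimes f)(\widetilde{\mathrm{coev}}_V\otimes\mathrm{id}_P)\bigr)$ for all $f\colon V\otimes P\to\Sigma(V\otimes P)=V\otimes\Sigma(P)$. A right (left) modified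 trace is a right (left) module trace for $\Sigma=\mathrm{Id}$. A trace $\mathsf t$ is non-degenerate if all pairings $\mathrm{Hom}_H(P',\Sigma P)\times\mathrm{Hom}_H(P,P')\to\Bbbk$, $(f,g)\mapsto\mathsf t_P(f\circ g)$, are non-degenerate. *)

(* Defs.v *)
From HB Require Import structures.
From mathcomp Require Import all_boot all_order all_algebra.

Set Implicit Arguments.
Unset Strict Implicit.
Unset Printing Implicit Defensive.

Import GRing.Theory.
Local Open Scope ring_scope.
Local Open Scope lfun_scope.

(* Tensor products of finite-dimensional vector spaces, realized on matrices
   of coordinates; [tlift_tensv] and [tens_ext] below give the universal property. *)

Definition tens (k : fieldType) (U W : vectType k) : vectType k :=
  'M[k]_(\dim {:U}, \dim {:W}).

Notation "U \ox W" := (tens U W) (at level 40, left associativity) : type_scope.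

Definition tensv (k : fieldType) (U W : vectType k) (u : U) (w : W) : U \ox W :=
  \matrix_(i, j) (coord (vbasis {:U}) i u * coord (vbasis {:W}) j w).

Notation "u \oxv w" := (tensv u w) (at level 40, left associativity) : ring_scope.

(* the linear map U \ox W -> Z induced by a bilinear map b *)
Definition tlift (k : fieldType) (U W Z : vectType k) (b : U -> W -> Z) :
    'Hom(U \ox W, Z) :=
  linfun (fun t : 'M[k]_(\dim {:U}, \dim {:W}) =>
    \sum_i \sum_j t i j *: b (vbasis {:U})`_i (vbasis {:W})`_j).

Definition tmap (k : fieldType) (U W U' W' : vectType k)
    (f : 'Hom(U, U')) (g : 'Hom(W, W')) : 'Hom(U \ox W, U' \ox W') :=
  tlift (fun u w => f u \oxv g w).

Notation "f \oxf g" := (tmap f g) (at level 40, left associativity) : lfun_scope.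

Section TensorMaps.
Variable k : fieldType.
Implicit Types U W X Y : vectType k.

Definition tassoc U W X : 'Hom(U \ox W \ox X, U \ox (W \ox X)) :=
  tlift (fun (t : U \ox W) x =>
           tlift (fun u w => u \oxv (w \oxv x)) t).

Definition tassocV U W X : 'Hom(U \ox (W \ox X), U \ox W \ox X) :=
  tlift (fun u (t : W \ox X) => tlift (fun w x => u \oxv w \oxv x) t).

Definition tswap U W X Y :
    'Hom((U \ox W) \ox (X \ox Y), (U \ox X) \ox (W \ox Y)) :=
  tlift (fun (s : U \ox W) (t : X \ox Y) =>
    tlift (fun u w => tlift (fun x y => (u \oxv x) \oxv (w \oxv y)) t) s).

Definition trunit U : 'Hom(U \ox k^o, U) := tlift (fun u (c : k^o) => c *: u).
Definition trunitV U : 'Hom(U, U \ox k^o) := linfun (fun u => u \oxv (1 : k^o)).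
Definition tlunit U : 'Hom(k^o \ox U, U) := tlift (fun (c : k^o) u => c *: u).
Definition tlunitV U : 'Hom(U, k^o \ox U) := linfun (fun u => (1 : k^o) \oxv u).

End TensorMaps.

Section TensorTheory.
Variable k : fieldType.
Implicit Types A B V U W X Y Z : vectType k.

Definition bilin U W Z (b : U -> W -> Z) : Prop :=
  (forall c u u' w, b (c *: u + u') w = c *: b u w + b u' w) /\
  (forall c u w w', b u (c *: w + w') = c *: b u w + b u w').

Lemma linfunE U W (f : U -> W) : linear f -> linfun f =1 f.
Proof.
move=> lf u; pose F := GRing.isLinear.Build _ _ _ _ f lf.
by pose g : {linear U -> W} := HB.pack f F; rewrite (lfunE g).
Qed.

Lemma vbasis_sum U (u : U) :
  u = \sum_i coord (vbasis {:U}) i u *: (vbasis {:U})`_i.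
Proof. exact: coord_vbasis (memvf u). Qed.

Lemma tliftE U W Z (b : U -> W -> Z) (t : 'M[k]_(\dim {:U}, \dim {:W})) :
  tlift b t = \sum_i \sum_j t i j *: b (vbasis {:U})`_i (vbasis {:W})`_j.
Proof.
rewrite /tlift linfunE // => c s r.
rewrite scaler_sumr -big_split; apply: eq_bigr => i _ /=.
rewrite scaler_sumr -big_split; apply: eq_bigr => j _ /=.
by rewrite !mxE scalerDl scalerA.
Qed.

Lemma bilin0l U W Z (b : U -> W -> Z) w : bilin b -> b 0 w = 0.
Proof.
by case=> bl _; have := bl (-1) 0 0 w; rewrite !scaleN1r !addNr.
Qed.

Lemma bilinZl U W Z (b : U -> W -> Z) c u w :
  bilin b -> b (c *: u) w = c *: b u w.
Proof. by move=> hb; rewrite -[c *: u]addr0 (proj1 hb) (bilin0l _ hb) addr0. Qed.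

Lemma bilinZr U W Z (b : U -> W -> Z) c u w :
  bilin b -> b u (c *: w) = c *: b u w.
Proof. by case=> b1 b2; apply: (@bilinZl _ _ _ (fun w u => b u w)). Qed.

Lemma bilin_suml U W Z (b : U -> W -> Z) I (r : seq I) (c : I -> k) F w :
  bilin b -> b (\sum_(i <- r) c i *: F i) w = \sum_(i <- r) c i *: b (F i) w.
Proof.
move=> hb; elim: r => [|i r IH]; first by rewrite !big_nil bilin0l.
by rewrite !big_cons (proj1 hb) IH.
Qed.

Lemma bilin_sumr U W Z (b : U -> W -> Z) I (r : seq I) (c : I -> k) F u :
  bilin b -> b u (\sum_(i <- r) c i *: F i) = \sum_(i <- r) c i *: b u (F i).
Proof. by case=> b1 b2; apply: (@bilin_suml _ _ _ (fun w u => b u w)). Qed.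

Lemma tlift_tensv U W Z (b : U -> W -> Z) u w :
  bilin b -> tlift b (u \oxv w) = b u w.
Proof.
move=> hb; rewrite tliftE [in RHS](vbasis_sum u) bilin_suml //.
apply: eq_bigr => i _; rewrite [in RHS](vbasis_sum w).
rewrite bilin_sumr // scaler_sumr; apply: eq_bigr => j _.
by rewrite scalerA mxE.
Qed.

Lemma tensv_bilin U W : bilin (@tensv k U W).
Proof.
split=> c *; apply/matrixP => i j; rewrite !mxE linearP /=.
  by rewrite mulrDl mulrA.
by rewrite mulrDr mulrCA.
Qed.

Lemma coord_vbasisE U (i j : 'I_(\dim {:U})) :
  coord (vbasis {:U}) i (vbasis {:U})`_j = (i == j)%:R.
Proof. by rewrite coord_free ?(basis_free (vbasisP _)) // eq_sym. Qed.

Lemma tens_sum U W (t : 'M[k]_(\dim {:U}, \dim {:W})) :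
  t = \sum_i \sum_j t i j *: ((vbasis {:U})`_i \oxv (vbasis {:W})`_j).
Proof.
rewrite [LHS]matrix_sum_delta.
apply: eq_bigr => i _; apply: eq_bigr => j _; congr (_ *: _).
by apply/matrixP => a b; rewrite !mxE !coord_vbasisE mulr_natl mulrb; do 2 case: eqP.
Qed.

Lemma tens_ext U W Z (f g : 'Hom(U \ox W, Z)) :
  (forall u w, f (u \oxv w) = g (u \oxv w)) -> f = g.
Proof.
move=> efg; apply/lfunP => t; rewrite (tens_sum t) !linear_sum.
apply: eq_bigr => i _; rewrite !linear_sum; apply: eq_bigr => j _.
by rewrite !linearZ /= efg.
Qed.

Lemma bilin_lin U W Z Z' (b : U -> W -> Z) (h : 'Hom(Z, Z')) :
  bilin b -> bilin (fun u w => h (b u w)).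
Proof. by case=> b1 b2; split=> *; rewrite ?b1 ?b2 linearP. Qed.

Lemma bilin_comp U W U' W' Z (b : U' -> W' -> Z) (f : 'Hom(U, U'))
    (g : 'Hom(W, W')) : bilin b -> bilin (fun u w => b (f u) (g w)).
Proof. by case=> b1 b2; split=> *; rewrite linearP ?b1 ?b2. Qed.

Lemma tmapE U W U' W' (f : 'Hom(U, U')) (g : 'Hom(W, W')) u w :
  (f \oxf g) (u \oxv w) = f u \oxv g w.
Proof. by rewrite /tmap tlift_tensv //; apply: bilin_comp; apply: tensv_bilin. Qed.

Lemma tlift_bilinl U W Z X (b : X -> U -> W -> Z) t :
  (forall c x y u w, b (c *: x + y) u w = c *: b x u w + b y u w) ->
  forall c x y, tlift (b (c *: x + y)) t = c *: tlift (b x) t + tlift (b y) t.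
Proof.
move=> hb c x y; rewrite !tliftE scaler_sumr -big_split; apply: eq_bigr => i _ /=.
rewrite scaler_sumr -big_split; apply: eq_bigr => j _ /=.
by rewrite hb scalerDr !scalerA mulrC.
Qed.

Lemma tmap_comp U W U1 W1 U2 W2 (f : 'Hom(U, U1)) (g : 'Hom(W, W1))
   (f' : 'Hom(U1, U2)) (g' : 'Hom(W1, W2)) :
  (f' \oxf g') \o (f \oxf g) = (f' \o f) \oxf (g' \o g).
Proof. by apply: tens_ext => u w; rewrite !comp_lfunE !tmapE !comp_lfunE. Qed.

Lemma tmap1 U W : (\1 : 'End(U)) \oxf (\1 : 'End(W)) = \1.
Proof. by apply: tens_ext => u w; rewrite tmapE !id_lfunE. Qed.

Lemma tmap_bilin U W U' W' : bilin (@tmap k U W U' W').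
Proof.
split=> c f f' g; apply: tens_ext => u w; rewrite add_lfunE scale_lfunE !tmapE.
  by rewrite add_lfunE scale_lfunE (proj1 (tensv_bilin _ _)).
by rewrite add_lfunE scale_lfunE (proj2 (tensv_bilin _ _)).
Qed.

Lemma tswapE U W X Y (u : U) (w : W) (x : X) (y : Y) :
  tswap U W X Y ((u \oxv w) \oxv (x \oxv y)) = (u \oxv x) \oxv (w \oxv y).
Proof.
have [l1 l2] := @tensv_bilin U X; have [m1 m2] := @tensv_bilin W Y.
have [n1 n2] := @tensv_bilin (U \ox X) (W \ox Y).
have b1 u' w' : bilin (fun x y => (u' \oxv x) \oxv (w' \oxv y) : (U \ox X) \ox (W \ox Y)).
  by split=> *; rewrite ?l2 ?m2 ?n1 ?n2.
have b2 (t : X \ox Y) : bilin (fun (u : U) (w : W) => tlift (fun (x : X) (y : Y) => (u \oxv x) \oxv (w \oxv y)) t).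
  split=> c a b d.
    refine (@tlift_bilinl X Y _ U (fun u x y => (u \oxv x) \oxv (d \oxv y)) t _ c a b).
    by move=> *; rewrite l1 n1.
  refine (@tlift_bilinl X Y _ W (fun w x y => (a \oxv x) \oxv (w \oxv y)) t _ c b d).
  by move=> *; rewrite m1 n2.
rewrite /tswap tlift_tensv; first by rewrite tlift_tensv // tlift_tensv.
split=> c s s' t; first by rewrite linearP.
refine (@tlift_bilinl U W _ (X \ox Y)
  (fun t u w => tlift (fun x y => (u \oxv x) \oxv (w \oxv y)) t) s _ c s' t).
by move=> *; rewrite linearP.
Qed.

Lemma tassocE U W X (u : U) (w : W) (x : X) :
  tassoc U W X ((u \oxv w) \oxv x) = u \oxv (w \oxv x).
Proof.
have [l1 l2] := @tensv_bilin W X; have [n1 n2] := @tensv_bilin U (W \ox X).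
have b1 (x' : X) : bilin (fun (u : U) (w : W) => u \oxv (w \oxv x')).
  by split=> *; rewrite ?l1 ?n1 ?n2.
rewrite /tassoc tlift_tensv ?tlift_tensv //.
split=> c s s' t; first by rewrite linearP.
refine (@tlift_bilinl U W _ X (fun x u w => u \oxv (w \oxv x)) s _ c s' t).
by move=> *; rewrite l2 n2.
Qed.

Lemma tassocVE U W X (u : U) (w : W) (x : X) :
  tassocV U W X (u \oxv (w \oxv x)) = (u \oxv w) \oxv x.
Proof.
have [l1 l2] := @tensv_bilin U W; have [n1 n2] := @tensv_bilin (U \ox W) X.
have b1 (u' : U) : bilin (fun (w : W) (x : X) => (u' \oxv w) \oxv x).
  by split=> *; rewrite ?l2 ?n1 ?n2.
rewrite /tassocV tlift_tensv ?tlift_tensv //.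
split=> c s s' t; last by rewrite linearP.
refine (@tlift_bilinl W X _ U (fun u w x => (u \oxv w) \oxv x) t _ c s s').
by move=> *; rewrite l1 n1.
Qed.

Lemma trunitE U (u : U) (c : k^o) : trunit U (u \oxv c) = c *: u.
Proof.
rewrite /trunit tlift_tensv //; split=> *.
  by rewrite scalerDr !scalerA mulrC.
by rewrite scalerDl scalerA.
Qed.

Lemma tlunitE U (c : k^o) (u : U) : tlunit U (c \oxv u) = c *: u.
Proof.
rewrite /tlunit tlift_tensv //; split=> *.
  by rewrite scalerDl scalerA.
by rewrite scalerDr !scalerA mulrC.
Qed.

Lemma lin_tens_ext U W Z (f g : U \ox W -> Z) : linear f -> linear g ->
  (forall u w, f (u \oxv w) = g (u \oxv w)) -> f =1 g.
Proof.
move=> lf lg efg t; rewrite -(linfunE lf) -(linfunE lg).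
by congr (fun_of_lfun _ _); apply: tens_ext => u w; rewrite !linfunE.
Qed.

Lemma comp_lfun_bilin U W X : bilin (fun (f : 'Hom(W, X)) (g : 'Hom(U, W)) => f \o g).
Proof.
by split=> *; apply/lfunP => u; rewrite !(add_lfunE, scale_lfunE, comp_lfunE) ?linearP.
Qed.

Lemma comp_lfun_suml U W X I (r : seq I) (F : I -> 'Hom(W, X)) (g : 'Hom(U, W)) :
  (\sum_(i <- r) F i) \o g = \sum_(i <- r) (F i \o g).
Proof.
elim: r => [|i r IH]; first by rewrite !big_nil comp_lfun0l.
by rewrite !big_cons comp_lfunDl IH.
Qed.

Lemma comp_lfun_sumr U W X I (r : seq I) (f : 'Hom(W, X)) (F : I -> 'Hom(U, W)) :
  f \o (\sum_(i <- r) F i) = \sum_(i <- r) (f \o F i).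
Proof.
elim: r => [|i r IH]; first by rewrite !big_nil comp_lfun0r.
by rewrite !big_cons comp_lfunDr IH.
Qed.

(* a (x) b acts as f a (x) g b *)
Definition tact A B V W (f : 'Hom(A, 'End(V))) (g : 'Hom(B, 'End(W))) :
    'Hom(A \ox B, 'End(V \ox W)) :=
  tlift (fun a b => f a \oxf g b).

Lemma tactE A B V W (f : 'Hom(A, 'End(V))) (g : 'Hom(B, 'End(W))) a b :
  tact f g (a \oxv b) = f a \oxf g b.
Proof. by rewrite /tact tlift_tensv //; apply/bilin_comp/tmap_bilin. Qed.

Lemma tactM A B V W (f : 'Hom(A, 'End(V))) (g : 'Hom(B, 'End(W)))
    (mA : 'Hom(A \ox A, A)) (mB : 'Hom(B \ox B, B)) s t :
  (forall a a', f (mA (a \oxv a')) = f a \o f a') ->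
  (forall b b', g (mB (b \oxv b')) = g b \o g b') ->
  tact f g ((mA \oxf mB) (tswap _ _ _ _ (s \oxv t))) = tact f g s \o tact f g t.
Proof.
move=> hf hg; have [b1 b2] := @comp_lfun_bilin (V \ox W) (V \ox W) (V \ox W).
have [t1 t2] := @tensv_bilin (A \ox B) (A \ox B).
move: s; apply: lin_tens_ext => [c s s'|c s s'|a b].
- by rewrite t1 !linearP.
- by rewrite linearP b1.
move: t; apply: lin_tens_ext => [c s s'|c s s'|a' b'].
- by rewrite t2 !linearP.
- by rewrite linearP b2.
by rewrite tswapE tmapE !tactE tmap_comp hf hg.
Qed.

Lemma tact_orth A B A' B' V W (f : 'Hom(A, 'End(V))) (g : 'Hom(B, 'End(W)))
    (f' : 'Hom(A', 'End(V))) (g' : 'Hom(B', 'End(W))) s t :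
  (forall a a', f a \o f' a' = 0) \/ (forall b b', g b \o g' b' = 0) ->
  tact f g s \o tact f' g' t = 0.
Proof.
move=> hfg; have [b1 b2] := @comp_lfun_bilin (V \ox W) (V \ox W) (V \ox W).
have [m1 m2] := @tmap_bilin V W V W.
move: s; apply: lin_tens_ext => [c s s'|c s s'|a b].
- by rewrite linearP b1.
- by rewrite scaler0 addr0.
move: t; apply: lin_tens_ext => [c s s'|c s s'|a' b'].
- by rewrite linearP b2.
- by rewrite scaler0 addr0.
rewrite !tactE tmap_comp; case: hfg => ->.
  by rewrite (bilin0l _ (tmap_bilin _ _ _ _)).
by have := m2 (-1) (f a \o f' a') 0 0; rewrite !scaleN1r !addNr.
Qed.

End TensorTheory.

(* transport along an equality of degrees *)
Definition hcast (k : fieldType) (I : Type) (F : I -> vectType k) (x y : I)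
    (e : x = y) : 'Hom(F x, F y) :=
  let: erefl := e in \1.

(* The algebras H_x are given by structure maps rather than as [algType]s,
   because H_x may be the zero algebra when x <> 1.  Finite type is built in,
   the H_x being [vectType]s. *)
Record hopfGcoalg (G : groupType) (k : fieldType) := HopfGCoalg {
  hsp :> G -> vectType k;
  hmul : forall x, 'Hom(hsp x \ox hsp x, hsp x);
  hone : forall x, hsp x;
  hdelta : forall x y : G, 'Hom(hsp (x * y)%g, hsp x \ox hsp y);
  heps : 'Hom(hsp 1%g, k^o);
  hS : forall x, 'Hom(hsp x, hsp x^-1%g);
  hmulA : forall x (a b c : hsp x),
    hmul x (a \oxv hmul x (b \oxv c)) = hmul x (hmul x (a \oxv b) \oxv c);
  hmul1l : forall x (a : hsp x), hmul x (hone x \oxv a) = a;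
  hmul1r : forall x (a : hsp x), hmul x (a \oxv hone x) = a;
  hdeltaM : forall x y (a b : hsp (x * y)%g),
    hdelta x y (hmul (x * y)%g (a \oxv b)) =
    (hmul x \oxf hmul y) (tswap _ _ _ _ (hdelta x y a \oxv hdelta x y b));
  hdelta1 : forall x y, hdelta x y (hone (x * y)%g) = hone x \oxv hone y;
  hepsM : forall a b : hsp 1%g, heps (hmul 1%g (a \oxv b)) = heps a * heps b;
  heps1 : heps (hone 1%g) = 1;
  hcoA : forall x y z : G,
    tassoc _ _ _ \o (hdelta x y \oxf \1) \o hdelta (x * y)%g z =
    (\1 \oxf hdelta y z) \o hdelta x (y * z)%g \o
      hcast hsp (esym (mulgA x y z));
  hcounitr : forall x : G,
    trunit _ \o (\1 \oxf heps) \o hdelta x 1%g = hcast hsp (mulg1 x);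
  hcounitl : forall x : G,
    tlunit _ \o (heps \oxf \1) \o hdelta 1%g x = hcast hsp (mul1g x);
  hSl : forall (x : G) (h : hsp 1%g),
    hmul x (((hcast hsp (invgK x) \o hS x^-1%g) \oxf \1)
      (hdelta x^-1%g x (hcast hsp (esym (mulVg x)) h))) = heps h *: hone x;
  hSr : forall (x : G) (h : hsp 1%g),
    hmul x ((\1 \oxf (hcast hsp (invgK x) \o hS x^-1%g))
      (hdelta x x^-1%g (hcast hsp (esym (mulgV x)) h))) = heps h *: hone x
}.

Arguments hone {G k _} x.
Arguments hmul {G k _} x.
Arguments hdelta {G k _} x y.
Arguments heps {G k _}.
Arguments hS {G k _} x.

Definition hm (G : groupType) (k : fieldType) (H : hopfGcoalg G k) (x : G)
  (a b : H x) : H x := hmul x (a \oxv b).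

Lemma hcastM (G : groupType) (k : fieldType) (H : hopfGcoalg G k) x y
    (e : x = y) (a b : H x) :
  hcast H e (hm a b) = hm (hcast H e a) (hcast H e b).
Proof. by case: y / e; rewrite /= !id_lfunE. Qed.

Lemma hcast1 (G : groupType) (k : fieldType) (H : hopfGcoalg G k) x y
    (e : x = y) : hcast H e (hone x) = hone y.
Proof. by case: y / e; rewrite /= id_lfunE. Qed.

(* [pivV] is the inverse, hence determined by [piv]. *)
Record pivot (G : groupType) (k : fieldType) (H : hopfGcoalg G k) := Pivot {
  piv :> forall x, H x;
  pivV : forall x, H x;
  piv_mulV : forall x, hm (piv x) (pivV x) = hone x;
  piv_Vmul : forall x, hm (pivV x) (piv x) = hone x;
  piv_delta : forall x y : G, hdelta x y (piv (x * y)%g) = piv x \oxv piv y;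
  piv_eps : heps (piv 1%g) = 1;
  piv_SS : forall x (a : H x),
    hcast H (invgK x) (hS x^-1%g (hS x a)) = hm (hm (piv x) a) (pivV x)
}.

Record grouplike (G : groupType) (k : fieldType) (H : hopfGcoalg G k) :=
  Grouplike {
    gl_fun :> 'Hom(H 1%g, k^o);
    gl_mul : forall a b : H 1%g, gl_fun (hm a b) = gl_fun a * gl_fun b;
    gl_one : gl_fun (hone 1%g) = 1
  }.

Definition left_cointegral (G : groupType) (k : fieldType)
    (H : hopfGcoalg G k) (c : H 1%g) : Prop :=
  forall a : H 1%g, hm a c = (heps a : k) *: c.

Definition is_modulus (G : groupType) (k : fieldType) (H : hopfGcoalg G k)
    (alpha : grouplike H) : Prop :=
  exists c : H 1%g, [/\ c != 0, left_cointegral c &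
    forall a : H 1%g, hm c a = (alpha a : k) *: c].

Definition unimodular (G : groupType) (k : fieldType) (H : hopfGcoalg G k) :
    Prop :=
  exists2 alpha : grouplike H, is_modulus alpha
    & gl_fun alpha = heps :> 'Hom(H 1%g, k^o).

(* An object of H-mod is a finite direct sum V = (+)_x V_x with V_x an
   H_x-module.  It is given by its total space V, on which a in H_x acts as
   given on V_x and as 0 on V_y for y <> x.  Hence 1_x acts as the projection
   onto V_x, and the last three axioms say that V is the direct sum of the
   V_x = 1_x V, where V_x = 0 unless x occurs in [gsupp]. *)
Record gmod (G : groupType) (k : fieldType) (H : hopfGcoalg G k) := GMod {
  gsp :> vectType k;
  gact : forall x, 'Hom(H x, 'End(gsp));
  gsupp : seq G;
  gactM : forall x (a b : H x), gact x (hm a b) = gact x a \o gact x b;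
  gact_orth : forall x y (a : H x) (b : H y), x != y -> gact x a \o gact y b = 0;
  gsupp_uniq : uniq gsupp;
  gact1 : \sum_(x <- gsupp) gact x (hone x) = \1
}.

Arguments gact {G k H} g x.
Arguments gsupp {G k H} g.

(* Such maps commute with the projections 1_x, hence preserve degrees. *)
Definition gmod_hom (G : groupType) (k : fieldType) (H : hopfGcoalg G k)
    (V W : gmod H) (f : 'Hom(V, W)) : Prop :=
  forall x (a : H x), f \o gact V x a = gact W x a \o f.

Definition projective (G : groupType) (k : fieldType) (H : hopfGcoalg G k)
    (P : gmod H) : Prop :=
  forall (M N : gmod H) (e : 'Hom(M, N)) (f : 'Hom(P, N)),
    gmod_hom e -> limg e = fullv -> gmod_hom f ->
    exists2 f' : 'Hom(P, M), gmod_hom f' & e \o f' = f.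


Section Tensor.
Variables (G : groupType) (k : fieldType) (H : hopfGcoalg G k) (V W : gmod H).

(* Summand of the action of H_z on the tensor product which is nonzero only on
   V_x \ox W_(x^-1 z). *)
Definition tens_act_at (x z : G) : 'Hom(H z, 'End(V \ox W)) :=
  tact (gact V x) (gact W (x^-1 * z)%g) \o hdelta x (x^-1 * z)%g \o
    hcast H (esym (mulVKg x z)).

(* On V_x \ox W_y, an element h of H_(xy) acts through Delta_(x,y) h. *)
Definition tens_act (z : G) : 'Hom(H z, 'End(V \ox W)) :=
  \sum_(x <- gsupp V) tens_act_at x z.

Definition tens_supp : seq G :=
  undup [seq (x * y)%g | x <- gsupp V, y <- gsupp W].

Lemma tens_act_atM x z (a b : H z) :
  tens_act_at x z (hm a b) = tens_act_at x z a \o tens_act_at x z b.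
Proof.
rewrite /tens_act_at !comp_lfunE hcastM /hm hdeltaM.
by apply: tactM => *; apply: gactM.
Qed.

Lemma tens_act_at_orth x y z t (a : H z) (b : H t) :
  (x, z) != (y, t) -> tens_act_at x z a \o tens_act_at y t b = 0.
Proof.
rewrite /tens_act_at !comp_lfunE => ne; apply: tact_orth.
have [exy|nxy] := eqVneq x y; last by left=> *; apply: gact_orth.
right=> *; apply: gact_orth; apply: contra ne => /eqP; rewrite exy => /mulgI ->.
exact: eqxx.
Qed.

Lemma tens_actE z (a : H z) :
  tens_act z a = \sum_(x <- gsupp V) tens_act_at x z a.
Proof. by rewrite /tens_act sum_lfunE. Qed.

Lemma comp_sum (U1 U2 U3 : vectType k) I J (r : seq I) (s : seq J)
    (F : I -> 'Hom(U2, U3)) (K : J -> 'Hom(U1, U2)) :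
  (\sum_(i <- r) F i) \o (\sum_(j <- s) K j) =
  \sum_(i <- r) \sum_(j <- s) (F i \o K j).
Proof.
rewrite comp_lfun_suml; apply: eq_bigr => i _.
by rewrite comp_lfun_sumr.
Qed.

Lemma tens_actM z (a b : H z) :
  tens_act z (hm a b) = tens_act z a \o tens_act z b.
Proof.
rewrite !tens_actE comp_sum.
apply: eq_big_seq => x xV; rewrite (bigD1_seq x) ?gsupp_uniq //= -tens_act_atM.
rewrite big1 ?addr0 // => y; rewrite eq_sym => nxy.
by rewrite tens_act_at_orth // xpair_eqE (negPf nxy).
Qed.

Lemma tens_act_orth x y (a : H x) (b : H y) :
  x != y -> tens_act x a \o tens_act y b = 0.
Proof.
move=> nxy; rewrite !tens_actE comp_sum big1 // => i _; rewrite big1 // => j _.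
by rewrite tens_act_at_orth // xpair_eqE negb_and nxy orbT.
Qed.

Lemma gact_nsupp (U : gmod H) x a : x \notin gsupp U -> gact U x a = 0.
Proof.
move=> xU; rewrite -[LHS]comp_lfun1r -(gact1 U) comp_lfun_sumr big_seq big1 // => y yU.
by apply: gact_orth; apply: contraNneq xU => ->.
Qed.

Lemma tens_act1 : \sum_(z <- tens_supp) tens_act z (hone z) = \1.
Proof.
have E x z : tens_act_at x z (hone z) =
    gact V x (hone x) \oxf gact W (x^-1 * z)%g (hone _).
  by rewrite /tens_act_at !comp_lfunE hcast1 hdelta1 tactE.
under eq_bigr => z _ do rewrite tens_actE.
rewrite exchange_big /=.
have S x : x \in gsupp V -> \sum_(z <- tens_supp) tens_act_at x z (hone z) =
    gact V x (hone x) \oxf \1.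
  move=> xV; under eq_bigr => z _ do rewrite E.
  have lin (A : 'End(V)) I (r : seq I) (F : I -> 'End(W)) :
     A \oxf (\sum_(i <- r) F i) = \sum_(i <- r) (A \oxf F i).
    have := @bilin_sumr _ _ _ _ _ I r (fun=> 1) F A (tmap_bilin V W V W).
    by under eq_bigr do rewrite scale1r; under [in RHS]eq_bigr do rewrite scale1r.
  rewrite -lin; congr (_ \oxf _); rewrite -(gact1 W).
  rewrite -(big_map (fun z => (x^-1 * z)%g) xpredT (fun y => gact W y (hone y))).
  set s := map _ _.
  have us : uniq s by rewrite map_inj_uniq ?undup_uniq //; apply: mulgI.
  rewrite (bigID (fun y => y \in gsupp W)) /= addrC big1 ?add0r; last first.
    by move=> y; apply: gact_nsupp.
  rewrite -big_filter; apply: perm_big; apply: uniq_perm.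
  - exact: filter_uniq.
  - exact: gsupp_uniq.
  move=> y; rewrite mem_filter andb_idr // => yW.
  apply/mapP; exists (x * y)%g; last by rewrite mulKg.
  by rewrite mem_undup; apply/allpairsP; exists (x, y).
rewrite (eq_big_seq _ S).
have lin I (r : seq I) (F : I -> 'End(V)) (A : 'End(W)) :
   (\sum_(i <- r) F i) \oxf A = \sum_(i <- r) (F i \oxf A).
  have := @bilin_suml _ _ _ _ _ I r (fun=> 1) F A (tmap_bilin V W V W).
  by under eq_bigr do rewrite scale1r; under [in RHS]eq_bigr do rewrite scale1r.
by rewrite -lin gact1 tmap1.
Qed.

Definition gtens : gmod H :=
  GMod tens_actM tens_act_orth (undup_uniq _) tens_act1.

Lemma gtens_actE x y (h : H (x * y)%g) (v : V) (w : W) :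
    gact V x (hone x) v = v -> gact W y (hone y) w = w ->
  gact gtens (x * y)%g h (v \oxv w) =
  tact (gact V x) (gact W y) (hdelta x y h) (v \oxv w).
Proof.
move=> hv hw; rewrite [LHS]/= tens_actE sum_lfunE.
have Ex : tens_act_at x (x * y)%g h =
    tact (gact V x) (gact W y) (hdelta x y h).
  rewrite /tens_act_at !comp_lfunE.
  move: (esym _); have : y = (x^-1 * (x * y))%g by rewrite mulKg.
  move: (x^-1 * (x * y))%g => y' e; case: y' / e => e.
  by rewrite (eq_irrelevance e erefl) /= id_lfunE.
have [xV|xV] := boolP (x \in gsupp V); last first.
  have v0 : v = 0 by rewrite -hv gact_nsupp // zero_lfunE.
  rewrite v0 (bilin0l _ (tensv_bilin _ _)) linear0 big1 // => i _.
  by rewrite linear0.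
rewrite (bigD1_seq x) ?gsupp_uniq //= Ex big1 ?addr0 // => i ix.
rewrite -hv -[LHS]/((tens_act_at i (x * y)%g h) ((gact V x (hone x) v) \oxv w)).
rewrite -[X in _ \oxv X]hw -tmapE -tactE -comp_lfunE /tens_act_at !comp_lfunE -comp_lfunE.
by rewrite tact_orth ?zero_lfunE //; left=> *; apply: gact_orth.
Qed.

End Tensor.

(* Families of algebra endomorphisms.  The twist functor only needs the maps to
   be multiplicative and unital; [Rendo] and [Lendo] are in fact bijective. *)
Record algendo (G : groupType) (k : fieldType) (H : hopfGcoalg G k) := AlgEndo {
  ae_fun :> forall x, 'End(H x);
  ae_mul : forall x (a b : H x), ae_fun x (hm a b) = hm (ae_fun x a) (ae_fun x b);
  ae_one : forall x, ae_fun x (hone x) = hone x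
}.

Section Twist.
Variables (G : groupType) (k : fieldType) (H : hopfGcoalg G k).

Section TwistDef.
Variables (phi : algendo H) (V : gmod H).

Definition twist_act (x : G) : 'Hom(H x, 'End(V)) := gact V x \o phi x.

Lemma twist_actM x (a b : H x) :
  twist_act x (hm a b) = twist_act x a \o twist_act x b.
Proof. by rewrite /twist_act !comp_lfunE ae_mul gactM. Qed.

Lemma twist_act_orth x y (a : H x) (b : H y) :
  x != y -> twist_act x a \o twist_act y b = 0.
Proof. by move=> nxy; rewrite /twist_act !comp_lfunE gact_orth. Qed.

Lemma twist_act1 : \sum_(x <- gsupp V) twist_act x (hone x) = \1.
Proof.
rewrite -(gact1 V); apply: eq_bigr => x _.
by rewrite /twist_act comp_lfunE ae_one.
Qed.

Definition twist : gmod H :=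
  GMod twist_actM twist_act_orth (gsupp_uniq V) twist_act1.
End TwistDef.

Lemma id_algendoM x (a b : H x) : (\1 : 'End(H x)) (hm a b) =
  hm ((\1 : 'End(H x)) a) ((\1 : 'End(H x)) b).
Proof. by rewrite !id_lfunE. Qed.

Definition id_algendo : algendo H :=
  @AlgEndo G k H (fun x => \1) id_algendoM (fun x => id_lfunE _).

Variable nu : grouplike H.

(* R(nu) = (nu (x) id) Delta_(1,x) and L(nu) = (id (x) nu) Delta_(x,1) *)
Definition Rtw (x : G) : 'End(H x) :=
  tlunit _ \o (nu \oxf \1) \o hdelta 1%g x \o hcast H (esym (mul1g x)).

Definition Ltw (x : G) : 'End(H x) :=
  trunit _ \o (\1 \oxf nu) \o hdelta x 1%g \o hcast H (esym (mulg1 x)).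

Lemma hm_bilin x : bilin (@hm G k H x).
Proof.
by case: (tensv_bilin (H x) (H x)) => b1 b2; split=> *; rewrite /hm ?b1 ?b2 linearP.
Qed.

Lemma RtwM x (a b : H x) : Rtw x (hm a b) = hm (Rtw x a) (Rtw x b).
Proof.
rewrite /Rtw !(comp_lfunE _ (hcast _ _)) hcastM !(comp_lfunE _ (hdelta _ _)).
rewrite [X in hdelta _ _ X]/hm hdeltaM.
move: (hdelta _ _ _) (hdelta _ _ _) => t s.
have [t1 t2] := @tensv_bilin _ (H 1%g \ox H x) (H 1%g \ox H x).
have [b1 b2] := hm_bilin x.
move: s; apply: lin_tens_ext => [c s s'|c s s'|a1 a2].
- by rewrite t1 !linearP.
- by rewrite linearP b1.
move: t; apply: lin_tens_ext => [c s s'|c s s'|a1' a2'].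
- by rewrite t2 !linearP.
- by rewrite linearP b2.
rewrite tswapE tmapE !comp_lfunE !tmapE !id_lfunE !tlunitE.
by rewrite (bilinZl _ _ _ (hm_bilin x)) (bilinZr _ _ _ (hm_bilin x)) scalerA -gl_mul.
Qed.

Lemma Rtw1 x : Rtw x (hone x) = hone x.
Proof.
by rewrite /Rtw !comp_lfunE hcast1 hdelta1 tmapE gl_one id_lfunE tlunitE scale1r.
Qed.

Lemma LtwM x (a b : H x) : Ltw x (hm a b) = hm (Ltw x a) (Ltw x b).
Proof.
rewrite /Ltw !(comp_lfunE _ (hcast _ _)) hcastM !(comp_lfunE _ (hdelta _ _)).
rewrite [X in hdelta _ _ X]/hm hdeltaM.
move: (hdelta _ _ _) (hdelta _ _ _) => t s.
have [t1 t2] := @tensv_bilin _ (H x \ox H 1%g) (H x \ox H 1%g).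
have [b1 b2] := hm_bilin x.
move: s; apply: lin_tens_ext => [c s s'|c s s'|a1 a2].
- by rewrite t1 !linearP.
- by rewrite linearP b1.
move: t; apply: lin_tens_ext => [c s s'|c s s'|a1' a2'].
- by rewrite t2 !linearP.
- by rewrite linearP b2.
rewrite tswapE tmapE !comp_lfunE !tmapE !id_lfunE !trunitE.
by rewrite (bilinZl _ _ _ (hm_bilin x)) (bilinZr _ _ _ (hm_bilin x)) scalerA -gl_mul.
Qed.

Lemma Ltw1 x : Ltw x (hone x) = hone x.
Proof.
by rewrite /Ltw !comp_lfunE hcast1 hdelta1 tmapE gl_one id_lfunE trunitE scale1r.
Qed.

Definition Rendo : algendo H := AlgEndo RtwM Rtw1.
Definition Lendo : algendo H := AlgEndo LtwM Ltw1.

End Twist.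

Section Duality.
Variables (G : groupType) (k : fieldType) (H : hopfGcoalg G k) (g : pivot H).

(* Only the underlying space of the dual module enters the trace axioms. *)
Definition dualv (V : vectType k) : vectType k := 'Hom(V, k^o).

Variable V : gmod H.

Definition piv_act : 'End(V) := \sum_(x <- gsupp V) gact V x (piv g x).
Definition pivV_act : 'End(V) := \sum_(x <- gsupp V) gact V x (pivV g x).

Definition dbasis (i : 'I_(\dim {:V})) : dualv V :=
  linfun (coord (vbasis {:V}) i : V -> k^o).

Definition ev : 'Hom(dualv V \ox V, k^o) :=
  tlift (fun (xi : dualv V) (v : V) => fun_of_lfun xi v).

Definition coev : 'Hom(k^o, V \ox dualv V) :=
  linfun (fun c : k^o => (c : k) *: \sum_(i < \dim {:V}) ((vbasis {:V})`_i \oxv dbasis i)).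

Definition evt : 'Hom(V \ox dualv V, k^o) :=
  tlift (fun (v : V) (xi : dualv V) => fun_of_lfun xi (piv_act v)).

Definition coevt : 'Hom(k^o, dualv V \ox V) :=
  linfun (fun c : k^o =>
    (c : k) *: \sum_(i < \dim {:V}) (dbasis i \oxv pivV_act (vbasis {:V})`_i)).

(* (id (x) evt) (f (x) id) (id (x) coev), with the associativity and unit
   isomorphisms written out *)
Definition rptrace (P Q : vectType k) (f : 'Hom(P \ox V, Q \ox V)) : 'Hom(P, Q) :=
  trunit Q \o (\1 \oxf evt) \o tassoc _ _ _ \o (f \oxf \1) \o
    tassocV _ _ _ \o (\1 \oxf coev) \o trunitV P.

(* (ev (x) id) (id (x) f) (coevt (x) id) *)
Definition lptrace (P Q : vectType k) (f : 'Hom(V \ox P, V \ox Q)) : 'Hom(P, Q) :=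
  tlunit Q \o (ev \oxf \1) \o tassocV _ _ _ \o (\1 \oxf f) \o
    tassoc _ _ _ \o (coevt \oxf \1) \o tlunitV P.

End Duality.

Section Traces.
Variables (G : groupType) (k : fieldType) (H : hopfGcoalg G k) (g : pivot H).

(* A family of linear maps on Hom_H(P, twist phi P), P projective, is given by
   maps on all linear maps between the underlying spaces of all objects; only
   the values at [gmod_hom]s with P projective are constrained or used. *)
Definition trace_family (phi : algendo H) : Type :=
  forall P : gmod H, 'Hom(P, twist phi P) -> k.

Section Twisted.
Variable phi : algendo H.
Implicit Type t : trace_family phi.

Definition trace_linear t : Prop :=
  forall (P : gmod H) (c : k) (f f' : 'Hom(P, twist phi P)), projective P ->
    gmod_hom f -> gmod_hom f' -> t P (c *: f + f') = c * t P f + t P f'.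

(* The functor [twist phi] is the identity on morphisms. *)
Definition trace_cyclic t : Prop :=
  forall (P P' : gmod H) (h : 'Hom(P, P')) (f : 'Hom(P', twist phi P)),
    projective P -> projective P' -> gmod_hom h -> gmod_hom f ->
    t P (f \o h) = t P' ((h : 'Hom(twist phi P, twist phi P')) \o f).

Definition right_module_trace t : Prop :=
  [/\ trace_linear t, trace_cyclic t &
    forall (P V : gmod H) (f : 'Hom(gtens P V, twist phi (gtens P V))),
      projective P -> gmod_hom f ->
      t (gtens P V) f = t P (rptrace g (P := P) (Q := twist phi P) f)].

Definition left_module_trace t : Prop :=
  [/\ trace_linear t, trace_cyclic t &
    forall (V P : gmod H) (f : 'Hom(gtens V P, twist phi (gtens V P))),
      projective P -> gmod_hom f ->
      t (gtens V P) f = t P (lptrace g (P := P) (Q := twist phi P) f)].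

Definition trace_nonzero t : Prop :=
  exists P : gmod H, exists f : 'Hom(P, twist phi P),
    [/\ projective P, gmod_hom f & t P f != 0].

Definition trace_nondegenerate t : Prop :=
  forall P P' : gmod H, projective P -> projective P' ->
    (forall f : 'Hom(P', twist phi P), gmod_hom f ->
       (forall h : 'Hom(P, P'), gmod_hom h -> t P (f \o h) = 0) -> f = 0) /\
    (forall h : 'Hom(P, P'), gmod_hom h ->
       (forall f : 'Hom(P', twist phi P), gmod_hom f -> t P (f \o h) = 0) ->
       h = 0).

End Twisted.

(* Sigma = Id, as twisting by the identity changes neither the underlying space
   nor the action. *)
Definition right_modified_trace (t : trace_family (id_algendo H)) : Prop :=
  right_module_trace t.
Definition left_modified_trace (t : trace_family (id_algendo H)) : Prop :=
  left_module_trace t.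

End Traces.

(* Main.v *)
From HB Require Import structures.
Require Import Defs.
From mathcomp Require Import all_boot all_order all_algebra.

Set Implicit Arguments.
Unset Strict Implicit.
Unset Printing Implicit Defensive.

Import GRing.Theory.
Local Open Scope ring_scope.
Local Open Scope lfun_scope.

(** Write A for H_1, c for a non-zero left cointegral of A, so that
    c a = alpha(a) c, and use Sweedler notation c_1 (x) c_2 for any of the
    maps Delta_(x, x^-1).

    Averaging.  For H-modules V, W the algebra A acts on the linear maps from
    V to W by a.th = a_1 th S(a_2) ([homact]), and c.th is always a module
    morphism.  The average of a linear endomorphism of P can be the identity
    if and only if P is projective ([avg_projective], [projective_avg]).  The
    point is the free module A, for which one needs a functional om with
    c_1 om(S c_2) = 1 ([leg_eq_one]): the elements c_1 om(S c_2) form a left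
    ideal which is also a right coideal, and such a subspace is 0 or A.

    The trace.  For P projective choose th with c.th = id and put
    T_P(f) = tr(g f th) for f : P -> R(nu)P, where tr is the trace of linear
    maps and g the action of the pivot.  If nu = alpha this is independent of
    th: the element S(R(alpha) c) is again a left cointegral, hence a multiple
    kappa c ([cointegral_uniq]), and this says that c_1 (x) S c_2 is symmetric
    up to the twist a |-> g R(alpha)(a) g^-1 ([nakayama]).  Hence
    tr(g f th) = kappa tr(f th0 (c.th) g) when c.th0 = id, an expression in
    which th enters through its average only.  Cyclicity follows, and so does
    the partial trace property, because the average of th (x) id is
    (c.th) (x) id ([homact_tens]).  The scalar kappa is non-zero, since
    otherwise every f would vanish, and non-degeneracy reduces to that of
    (f, h) |-> tr(f h) on linear maps ([can_trace_nondegenerate]).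

    Uniqueness. Let t be any right module trace for R(nu). There is a constant
    K with t_P(f) = K tr(g f th) whenever c.th = id ([right_trace_formula]): P
    is a direct summand of A (x) P through the counit, with section the
    average of p |-> 1 (x) th p, and the partial trace over P of the
    endomorphism of A (x) P attached to f is tr(g f th) times a fixed map on
    A. If t is non-zero, then tr(g f th) depends on th only through c.th; but
    replacing th by a.th multiplies tr(g f th) by nu(a) ([lftrace_homact]) and
    c.th by alpha(a), so nu = alpha.

    Left traces are right traces for the co-opposite coalgebra over the
    opposite group ([cop]), with antipode S^-1 and pivot g^-1: it has the same
    cointegrals and modulus, and its R(nu) is the L(nu) of H. *)

(** * Linear maps given as plain functions *)

Section Linear.
Variable k : fieldType.
Implicit Types U V W X Y Z : vectType k.

(** A hypothesis on functions, rather than a type of linear maps, so that the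
    multilinear expressions of the Sweedler calculus can be written as they are;
    [lin_tac] below discharges it syntactically. *)
Definition lin U W (f : U -> W) : Prop :=
  forall c u v, f (c *: u + v) = c *: f u + f v.

Lemma lin_id U : lin (fun u : U => u).
Proof. by []. Qed.

Lemma lin_lfun U V W (h : 'Hom(V, W)) (f : U -> V) :
  lin f -> lin (fun u => h (f u)).
Proof. by move=> lf c u v; rewrite lf linearP. Qed.

Lemma lin_lapp U V W (h : U -> 'Hom(V, W)) (w : V) :
  lin h -> lin (fun u => h u w).
Proof. by move=> lf c u v; rewrite lf add_lfunE scale_lfunE. Qed.

Lemma lin_bilinl U V W Z (b : V -> W -> Z) (f : U -> V) (w : W) :
  bilin b -> lin f -> lin (fun u => b (f u) w).
Proof. by case=> b1 b2 lf c u v; rewrite lf b1. Qed.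

Lemma lin_bilinr U V W Z (b : V -> W -> Z) (f : U -> W) (w : V) :
  bilin b -> lin f -> lin (fun u => b w (f u)).
Proof. by case=> b1 b2 lf c u v; rewrite lf b2. Qed.

Lemma lin_tensl U V W (f : U -> V) (w : W) : lin f -> lin (fun u => f u \oxv w).
Proof. exact/(lin_bilinl w)/tensv_bilin. Qed.

Lemma lin_tensr U V W (f : U -> V) (w : W) : lin f -> lin (fun u => w \oxv f u).
Proof. exact/(lin_bilinr w)/tensv_bilin. Qed.

Lemma lin_compl U V W X (f : U -> 'Hom(V, W)) (h : 'Hom(X, V)) :
  lin f -> lin (fun u => f u \o h).
Proof. exact/(lin_bilinl h)/comp_lfun_bilin. Qed.

Lemma lin_compr U V W X (f : U -> 'Hom(X, V)) (h : 'Hom(V, W)) :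
  lin f -> lin (fun u => h \o f u).
Proof. exact/(lin_bilinr h)/comp_lfun_bilin. Qed.

Lemma lin_tmapl U V W V' W' (f : U -> 'Hom(V, W)) (h : 'Hom(V', W')) :
  lin f -> lin (fun u => f u \oxf h).
Proof. exact/(lin_bilinl h)/tmap_bilin. Qed.

Lemma lin_tmapr U V W V' W' (f : U -> 'Hom(V, W)) (h : 'Hom(V', W')) :
  lin f -> lin (fun u => h \oxf f u).
Proof. exact/(lin_bilinr h)/tmap_bilin. Qed.

Lemma lin_scalel U W (f : U -> k^o) (w : W) :
  lin f -> lin (fun u => (f u : k) *: w).
Proof. by move=> lf c u v; rewrite lf scalerDl scalerA. Qed.

Lemma lin_scaler U W (f : U -> W) (c : k) : lin f -> lin (fun u => c *: f u).
Proof. by move=> lf c' u v; rewrite lf scalerDr !scalerA mulrC. Qed.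

Lemma lin_mull U (f : U -> k^o) (c : k^o) :
  lin f -> lin (fun u => f u * c : k^o).
Proof. by move=> lf c' u v; rewrite lf mulrDl -scalerAl. Qed.

Lemma lin_mulr U (f : U -> k^o) (c : k^o) :
  lin f -> lin (fun u => c * f u : k^o).
Proof. by move=> lf c' u v; rewrite lf mulrDr -scalerAr. Qed.

Lemma lin_sum U W I (r : seq I) (P : pred I) (F : I -> U -> W) :
  (forall i, lin (F i)) -> lin (fun u => \sum_(i <- r | P i) F i u).
Proof.
move=> lF c u v; rewrite scaler_sumr -big_split; apply: eq_bigr => i _.
exact: lF.
Qed.

Lemma lin_tliftl X U W Z (b : X -> U -> W -> Z) (t : U \ox W) :
  (forall u w, lin (fun x => b x u w)) -> lin (fun x => tlift (b x) t).
Proof. by move=> lb c x y; apply: tlift_bilinl => *; apply: lb. Qed.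

Lemma bilinP U W Z (b : U -> W -> Z) :
  (forall w, lin (fun u => b u w)) -> (forall u, lin (fun w => b u w)) -> bilin b.
Proof. by move=> l r; split=> *; [apply: l | apply: r]. Qed.

Lemma linE U W (f : U -> W) : lin f -> linfun f =1 f.
Proof. by move=> lf; apply: linfunE. Qed.

Lemma lin0 U W (f : U -> W) : lin f -> f 0 = 0.
Proof. by move=> lf; rewrite -(linE lf) linear0. Qed.

Lemma linZ U W (f : U -> W) c u : lin f -> f (c *: u) = c *: f u.
Proof. by move=> lf; rewrite -!(linE lf) linearZ. Qed.

Lemma linD U W (f : U -> W) u v : lin f -> f (u + v) = f u + f v.
Proof. by move=> lf; rewrite -!(linE lf) linearD. Qed.

Lemma lin_bigsum U W (f : U -> W) I (r : seq I) (P : pred I) F :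
  lin f -> f (\sum_(i <- r | P i) F i) = \sum_(i <- r | P i) f (F i).
Proof.
by move=> lf; rewrite -(linE lf) linear_sum; apply: eq_bigr => i _; rewrite /= linE.
Qed.

Lemma eq_tlift U W Z (b b' : U -> W -> Z) t :
  (forall u w, b u w = b' u w) -> tlift b t = tlift b' t.
Proof.
by move=> eb; rewrite !tliftE; apply: eq_bigr => i _; apply: eq_bigr => j _; rewrite eb.
Qed.

Lemma lin_tlift U W Z X (F : Z -> X) (b : U -> W -> Z) t :
  lin F -> F (tlift b t) = tlift (fun u w => F (b u w)) t.
Proof.
move=> lF; rewrite !tliftE lin_bigsum //; apply: eq_bigr => i _.
by rewrite lin_bigsum //; apply: eq_bigr => j _; rewrite linZ.
Qed.

Lemma exchange_tlift U W U' W' Z (b : U -> W -> U' -> W' -> Z) t t' :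
  tlift (fun u w => tlift (b u w) t') t =
  tlift (fun u' w' => tlift (fun u w => b u w u' w') t) t'.
Proof.
have E (U1 W1 Z1 : vectType k) (b1 : U1 -> W1 -> Z1) (s : U1 \ox W1) : tlift b1 s =
    \sum_ij (s : 'M_(_, _)) ij.1 ij.2 *: b1 (vbasis {:U1})`_ij.1 (vbasis {:W1})`_ij.2.
  by rewrite tliftE pair_big.
rewrite !E; under eq_bigr => i _ do rewrite E scaler_sumr.
rewrite exchange_big; apply: eq_bigr => i _ /=; rewrite E scaler_sumr.
by apply: eq_bigr => j _; rewrite !scalerA mulrC.
Qed.

Lemma tlift_sum U W Z I (r : seq I) (b : I -> U -> W -> Z) t :
  tlift (fun u w => \sum_(i <- r) b i u w) t = \sum_(i <- r) tlift (b i) t.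
Proof.
rewrite tliftE; under [RHS]eq_bigr => i _ do rewrite tliftE.
rewrite [RHS]exchange_big; apply: eq_bigr => j _ /=.
rewrite [RHS]exchange_big; apply: eq_bigr => l _ /=.
by rewrite scaler_sumr.
Qed.

Lemma tens_tlift U W (t : U \ox W) : t = tlift (fun u w => u \oxv w) t.
Proof. by rewrite tliftE -tens_sum. Qed.

(** The dual basis as morphisms, which unlike [coord] are seen by [lin_tac]. *)
Definition bcoord U (i : 'I_(\dim {:U})) : 'Hom(U, k^o) :=
  linfun (coord (vbasis {:U}) i : U -> k^o).

Lemma bcoordE U i (u : U) : bcoord i u = coord (vbasis {:U}) i u.
Proof. by rewrite /bcoord linfunE // => c v w; rewrite linearP. Qed.

Lemma bcoord_sum U (u : U) : u = \sum_i (bcoord i u : k) *: (vbasis {:U})`_i.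
Proof. by rewrite {1}(vbasis_sum u); apply: eq_bigr => i _; rewrite bcoordE. Qed.

Lemma scalC (a b : k^o) : (a : k) *: b = (b : k) *: a.
Proof. exact: mulrC. Qed.

Lemma exists_dual (V : vectType k) (v : V) : v != 0 -> exists om : 'Hom(V, k^o), om v = 1.
Proof.
move=> v0; have /existsP[i vi] : [exists i, coord (vbasis {:V}) i v != 0].
  apply: contraNT v0; rewrite negb_exists => /forallP v0.
  by rewrite (vbasis_sum v) big1 // => i _; move: (v0 i); rewrite negbK => /eqP->; rewrite scale0r.
pose f (u : V) : k^o := coord (vbasis {:V}) i u / coord (vbasis {:V}) i v.
have lf : lin f by move=> a u w; rewrite /f linearP mulrDl -mulrA.
by exists (linfun f); rewrite linE // /f divff.
Qed.

End Linear.

(** * Graded Sweedler calculus *)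

Lemma lin_comp (k : fieldType) (U V W : vectType k) (F : V -> W) (f : U -> V) :
  lin F -> lin f -> lin (fun u => F (f u)).
Proof. by move=> lF lf c u v; rewrite lf lF. Qed.

Section Sweedler.
Variables (G : groupType) (k : fieldType) (H : hopfGcoalg G k).
Implicit Types (x y z s t r : G) (Z : vectType k).

(** Total casts, zero when the degrees differ: equalities between degrees then
    remain hypotheses of lemmas and never occur inside terms. *)
Definition degcast x y : 'Hom(H x, H y) :=
  if x =P y is ReflectT e then hcast H e else 0.

Lemma degcastE x y (e : x = y) : hcast H e = degcast x y.
Proof.
rewrite /degcast; case: eqP => [e'|//]; by rewrite (eq_irrelevance e e').
Qed.

Lemma degcastxx x (a : H x) : degcast x x a = a.
Proof. by rewrite -(degcastE erefl) id_lfunE. Qed.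

Lemma degcastK x y (a : H x) : x = y -> degcast y x (degcast x y a) = a.
Proof. by move=> e; case: y / e; rewrite !degcastxx. Qed.

Definition codelta x y z : 'Hom(H z, H x \ox H y) := hdelta x y \o degcast z (x * y)%g.

(** [sw (fun u v => b u v) a] is the Sweedler sum b(a_1, a_2), for the
    component of the coproduct given by the degrees of u and v. *)
Definition sw Z x y z (b : H x -> H y -> Z) (a : H z) : Z := tlift b (codelta x y z a).

Definition antip x y : 'Hom(H x, H y) := degcast x^-1%g y \o hS x.

Lemma eq_sw Z x y z (b b' : H x -> H y -> Z) (a : H z) :
  (forall u v, b u v = b' u v) -> sw b a = sw b' a.
Proof. exact: eq_tlift. Qed.

Lemma sw_lin Z Z' x y z (F : Z -> Z') (b : H x -> H y -> Z) (a : H z) :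
  lin F -> F (sw b a) = sw (fun u v => F (b u v)) a.
Proof. exact: lin_tlift. Qed.

Lemma sw0 Z x y z (b : H x -> H y -> Z) (a : H z) :
  (forall u v, b u v = 0) -> sw b a = 0.
Proof.
move=> b0; rewrite /sw tliftE big1 // => i _; rewrite big1 // => j _.
by rewrite b0 scaler0.
Qed.

Lemma sw_sum Z I (r : seq I) x y z (b : I -> H x -> H y -> Z) (a : H z) :
  sw (fun u v => \sum_(i <- r) b i u v) a = \sum_(i <- r) sw (b i) a.
Proof. exact: tlift_sum. Qed.

Lemma sw_exchange Z x y z x' y' z'
    (b : H x -> H y -> H x' -> H y' -> Z) (a : H z) (a' : H z') :
  sw (fun u v => sw (b u v) a') a = sw (fun u' v' => sw (fun u v => b u v u' v') a) a'.
Proof. exact: exchange_tlift. Qed.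

Lemma lin_swa (U : vectType k) Z x y z (f : U -> H z) (b : H x -> H y -> Z) :
  lin f -> lin (fun u : U => sw b (f u)).
Proof. by move=> lf; apply: (lin_lfun (tlift b)); apply: lin_lfun. Qed.
Lemma lin_swb Z (X : vectType k) x y z (b : X -> H x -> H y -> Z) (a : H z) :
  (forall u v, lin (fun q : X => b q u v)) -> lin (fun q : X => sw (b q) a).
Proof. exact: lin_tliftl. Qed.

End Sweedler.

Ltac lin_step := intros;
  match goal with
  | |- bilin _ => apply bilinP
  | |- lin (fun u => u) => apply lin_id
  | |- lin (fun_of_lfun ?h) => apply (lin_lfun h (@lin_id _ _))
  | |- lin (hm ?w) => apply (lin_bilinr w (@hm_bilin _ _ _ _) (@lin_id _ _))
  | |- lin (sw ?b) => apply (lin_swa b (@lin_id _ _))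
  | |- lin (fun u => fun_of_lfun ?h (@?f u)) => apply (lin_lfun h (f := f))
  | |- lin (fun u => fun_of_lfun (tlift (@?b u)) ?t) => apply (lin_tliftl (b := b) t)
  | |- lin (fun u => fun_of_lfun (@?h u) ?w) => apply (lin_lapp (h := h) w)
  | |- lin (fun u => hm (@?f u) ?w) => apply (lin_bilinl (f := f) w (@hm_bilin _ _ _ _))
  | |- lin (fun u => hm ?w (@?f u)) => apply (lin_bilinr (f := f) w (@hm_bilin _ _ _ _))
  | |- lin (fun u => tensv (@?f u) ?w) => apply (lin_tensl (f := f) w)
  | |- lin (fun u => tensv ?w (@?f u)) => apply (lin_tensr (f := f) w)
  | |- lin (fun u => comp_lfun (@?f u) ?w) => apply (lin_compl (f := f) w)
  | |- lin (fun u => comp_lfun ?w (@?f u)) => apply (lin_compr (f := f) w)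
  | |- lin (fun u => tmap (@?f u) ?w) => apply (lin_tmapl (f := f) w)
  | |- lin (fun u => tmap ?w (@?f u)) => apply (lin_tmapr (f := f) w)
  | |- lin (fun u => sw ?b (@?f u)) => apply (lin_swa (f := f) b)
  | |- lin (fun u => sw (@?b u) ?t) => apply (lin_swb (b := b) t)
  | |- lin (fun u => GRing.scale (@?f u) ?w) => apply (lin_scalel (f := f) w)
  | |- lin (fun u => GRing.scale ?w (@?f u)) => apply (lin_scaler (f := f) w)
  | |- lin (fun u => GRing.mul (@?f u) ?w) => apply (lin_mull (f := f) w)
  | |- lin (fun u => GRing.mul ?w (@?f u)) => apply (lin_mulr (f := f) w)
  | |- lin (fun u => bigop _ _ _) => apply lin_sum
  | H : bilin ?F |- lin (fun u => ?F (@?f u) ?w) => apply (lin_bilinl (f := f) w H)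
  | H : bilin ?F |- lin (fun u => ?F ?w (@?f u)) => apply (lin_bilinr (f := f) w H)
  | H : bilin ?F |- lin (?F ?w) => apply (lin_bilinr w H (@lin_id _ _))
  | H : lin ?F |- lin (fun u => ?F (@?f u)) => apply (lin_comp (f := f) H)
  | H : lin ?F |- lin ?F => exact H
  | H : _ |- lin _ => apply H
  end.
Ltac lin_tac := repeat (lin_step; cbv beta).

Section SweedlerLaws.
Variables (G : groupType) (k : fieldType) (H : hopfGcoalg G k).
Implicit Types (x y z s t r : G) (Z : vectType k).

(** The two ways of writing T(h_1, h_2, h_3) as a nested sum. *)
Lemma sw_coA Z x y z s t r (T : H x -> H y -> H z -> Z) (h : H r) :
  s = (x * y)%g -> t = (y * z)%g -> r = (s * z)%g ->
  (forall b c, lin (fun a => T a b c)) -> (forall a c, lin (fun b => T a b c)) ->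
  (forall a b, lin (T a b)) ->
  sw (fun (u : H s) w => sw (fun a b => T a b w) u) h =
  sw (fun a (v : H t) => sw (T a) v) h.
Proof.
move=> es et er T1 T2 T3; subst s t r.
pose L : 'Hom(H x \ox (H y \ox H z), Z) := tlift (fun a v => tlift (T a) v).
have LE a v : L (a \oxv v) = tlift (T a) v by rewrite /L tlift_tensv //; lin_tac.
have := hcoA H x y z => /(congr1 (fun f : 'Hom(_, _) => L (f h))).
rewrite !comp_lfunE (@degcastE G k H) => E.
transitivity (L (tassoc _ _ _ ((hdelta x y \oxf \1) (hdelta (x * y)%g z h)))).
  rewrite /sw /codelta !comp_lfunE degcastxx [in RHS](tens_tlift (hdelta _ _ h)).
  rewrite [in RHS](lin_tlift (F := fun q => L (tassoc _ _ _ ((hdelta x y \oxf \1) q))));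
    last by lin_tac.
  apply: eq_tlift => u w; rewrite tmapE id_lfunE.
  rewrite comp_lfunE degcastxx [in RHS](tens_tlift (hdelta _ _ u)).
  rewrite [in RHS](lin_tlift (F := fun q => L (tassoc _ _ _ (q \oxv w)))); last by lin_tac.
  apply: eq_tlift => a b; rewrite tassocE LE tlift_tensv //; lin_tac.
rewrite E /sw /codelta !comp_lfunE [in LHS](tens_tlift (hdelta x _ _)).
rewrite [in LHS](lin_tlift (F := fun q => L ((\1 \oxf hdelta y z) q))); last by lin_tac.
by apply: eq_tlift => a v; rewrite tmapE id_lfunE LE comp_lfunE degcastxx.
Qed.

Lemma sw_counitr Z x (F : H x -> Z) (h : H x) : lin F ->
  sw (fun (u : H x) (v : H 1%g) => (heps v : k) *: F u) h = F h.
Proof.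
move=> lF; have := hcounitr H x =>
  /(congr1 (fun f : 'Hom(_, _) => F (f (degcast H x (x * 1)%g h)))).
rewrite (@degcastE G k H) degcastK ?mulg1 // => <-.
rewrite !comp_lfunE /sw /codelta comp_lfunE [in RHS](tens_tlift (hdelta x _ _)).
rewrite [in RHS](lin_tlift (F := fun q => F (trunit _ ((\1 \oxf heps) q)))); last by lin_tac.
by apply: eq_tlift => a v; rewrite tmapE id_lfunE trunitE linZ.
Qed.

Lemma sw_counitl Z x (F : H x -> Z) (h : H x) : lin F ->
  sw (fun (u : H 1%g) (v : H x) => (heps u : k) *: F v) h = F h.
Proof.
move=> lF; have := hcounitl H x =>
  /(congr1 (fun f : 'Hom(_, _) => F (f (degcast H x (1 * x)%g h)))).
rewrite (@degcastE G k H) degcastK ?mul1g // => <-.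
rewrite !comp_lfunE /sw /codelta comp_lfunE [in RHS](tens_tlift (hdelta _ x _)).
rewrite [in RHS](lin_tlift (F := fun q => F (tlunit _ ((heps \oxf \1) q)))); last by lin_tac.
by apply: eq_tlift => a v; rewrite tmapE id_lfunE tlunitE linZ.
Qed.

Lemma sw_antipl Z x y (F : H x -> Z) (h : H 1%g) : y = x^-1%g -> lin F ->
  sw (fun (u : H y) (v : H x) => F (hm (antip H y x u) v)) h = (heps h : k) *: F (hone x).
Proof.
move=> ey lF; subst y; rewrite -linZ // -hSl /sw /codelta comp_lfunE !(@degcastE G k H).
rewrite [in RHS](tens_tlift (hdelta _ x _)).
rewrite [in RHS](lin_tlift (F := fun q => F (hmul x ((_ \oxf \1) q)))); last by lin_tac.
by apply: eq_tlift => a v; rewrite tmapE id_lfunE.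
Qed.

Lemma sw_antipr Z x y (F : H x -> Z) (h : H 1%g) : y = x^-1%g -> lin F ->
  sw (fun (u : H x) (v : H y) => F (hm u (antip H y x v))) h = (heps h : k) *: F (hone x).
Proof.
move=> ey lF; subst y; rewrite -linZ // -hSr /sw /codelta comp_lfunE !(@degcastE G k H).
rewrite [in RHS](tens_tlift (hdelta x _ _)).
rewrite [in RHS](lin_tlift (F := fun q => F (hmul x ((\1 \oxf _) q)))); last by lin_tac.
by apply: eq_tlift => a v; rewrite tmapE id_lfunE.
Qed.

Lemma sw_one Z x y z (b : H x -> H y -> Z) : z = (x * y)%g -> bilin b ->
  sw b (hone z) = b (hone x) (hone y).
Proof.
by move=> ez hb; subst z; rewrite /sw /codelta comp_lfunE degcastxx hdelta1 tlift_tensv.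
Qed.

Lemma sw_mul Z x y z (b : H x -> H y -> Z) (a a' : H z) : z = (x * y)%g -> bilin b ->
  sw b (hm a a') = sw (fun u v => sw (fun u' v' => b (hm u u') (hm v v')) a') a.
Proof.
move=> ez hb; subst z; rewrite /sw /codelta !comp_lfunE !degcastxx /hm hdeltaM.
rewrite [in LHS](tens_tlift (hdelta _ _ a)) [in LHS](tens_tlift (hdelta _ _ a')).
rewrite [in LHS](lin_tlift
    (F := fun q => tlift b ((hmul x \oxf hmul y) (tswap _ _ _ _ (q \oxv _)))));
  last by lin_tac.
apply: eq_tlift => u v.
rewrite [in LHS](lin_tlift
    (F := fun q => tlift b ((hmul x \oxf hmul y) (tswap _ _ _ _ (_ \oxv q)))));
  last by lin_tac.
by apply: eq_tlift => u' v'; rewrite tswapE tmapE tlift_tensv.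
Qed.

End SweedlerLaws.

(** * The antipode *)

Ltac gdeg := rewrite ?(mulg1, mul1g, mulgV, mulVg, invgK, mulgA, mulgK, mulgVK, mulKg,
  mulVKg, invg1, invgM); by [].

Section Antipode.
Variables (G : groupType) (k : fieldType) (H : hopfGcoalg G k).
Implicit Types (x y z : G).

Lemma hmA x (a b c : H x) : hm a (hm b c) = hm (hm a b) c.
Proof. exact: hmulA. Qed.

Lemma hm1l x (a : H x) : hm (hone x) a = a.
Proof. exact: hmul1l. Qed.

Lemma hm1r x (a : H x) : hm a (hone x) = a.
Proof. exact: hmul1r. Qed.

Lemma antip1 x y : y = x^-1%g -> antip H x y (hone x) = hone y.
Proof.
move=> e; have e' : x = y^-1%g by rewrite e invgK.
have := sw_antipl (F := fun q : H y => q) (hone 1%g) e' (@lin_id _ _).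
rewrite sw_one; [|by rewrite e mulgV|lin_tac].
by rewrite hm1r heps1 scale1r.
Qed.

(** Both S(ab) and S(b)S(a) are convolution inverse to the product; only one
    argument at a time is split, which keeps the nested sums short. *)
Lemma antipM x y (a b : H x) : y = x^-1%g ->
  antip H x y (hm a b) = hm (antip H x y b) (antip H x y a).
Proof.
move=> e; have e' : x = y^-1%g by rewrite e invgK.
have exy : 1%g = (x * y)%g by rewrite e mulgV.
have eyx : 1%g = (y * x)%g by rewrite e mulVg.
(* then S(ab) = S(a_1 b) a_2 S(a_3) = S(b) S(a) *)
have X (h : H 1%g) (b0 : H x) :
    sw (fun (a1 : H x) (a2 : H y) => hm (antip H x y (hm a1 b0)) a2) h =
    (heps h : k) *: antip H x y b0.
  transitivity (sw (fun (b1 : H 1%g) (b3 : H x) => sw (fun (u : H x) (v : H y) =>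
    hm (hm (antip H x y u) v) (antip H x y b3)) (hm h b1)) b0).
    under [RHS]eq_sw => b1 b3 do (rewrite sw_mul //; last by lin_tac).
    rewrite sw_exchange; apply: eq_sw => a1 a2.
    rewrite (sw_coA (t := 1%g)) //; [|gdeg|lin_tac|lin_tac|lin_tac].
    under [RHS]eq_sw => b1 b3.
      under eq_sw => u v do rewrite -!hmA.
      rewrite (sw_antipr (F := fun q => hm _ (hm _ q))) //; last by lin_tac.
      over.
    by rewrite (sw_counitr (F := fun q => hm (antip H x y (hm a1 q)) _)) ?hm1r //; lin_tac.
  under eq_sw => b1 b3.
    rewrite (sw_antipl (F := fun q => hm q _)) //; last by lin_tac.
    rewrite hm1l hepsM mulrC -scalerA.
    over.
  by rewrite (sw_counitl (F := fun q => heps h *: antip H x y q)) //; lin_tac.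
transitivity (sw (fun (a1 : H 1%g) (a3 : H x) => sw (fun (u : H x) (v : H y) =>
    hm (hm (antip H x y (hm u b)) v) (antip H x y a3)) a1) a).
  rewrite (sw_coA (t := 1%g)) //; [|gdeg|lin_tac|lin_tac|lin_tac].
  under [RHS]eq_sw => b1 b3.
    under eq_sw => u v do rewrite -!hmA.
    rewrite (sw_antipr (F := fun q => hm _ q)) //; last by lin_tac.
    over.
  by rewrite (sw_counitr (F := fun q => hm (antip H x y (hm q b)) _)) ?hm1r //; lin_tac.
under eq_sw => a1 a3.
  rewrite -(sw_lin (F := fun q => hm q _)); last by lin_tac.
  rewrite X (bilinZl _ _ _ (@hm_bilin _ _ _ _)).
  over.
by rewrite (sw_counitl (F := fun q => hm (antip H x y b) (antip H x y q))) //; lin_tac.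
Qed.

(** The dual of [antipM], by the same convolution argument in H_y' (x) H_x'. *)
Lemma antipD (Z : vectType k) x y z x' y' z' (F : H y' -> H x' -> Z) (a : H z) :
  z = (x * y)%g -> x' = x^-1%g -> y' = y^-1%g -> z' = z^-1%g -> bilin F ->
  sw F (antip H z z' a) = sw (fun (u : H x) (v : H y) => F (antip H y y' v) (antip H x x' u)) a.
Proof.
move=> ez ex ey ez' hF.
have Ex : x = x'^-1%g by rewrite ex invgK.
have Ey : y = y'^-1%g by rewrite ey invgK.
have Dz' : z' = (y' * x')%g by rewrite ez' ez ex ey; gdeg.
have Dy' : y' = (z' * x)%g by rewrite ez' ez ey; gdeg.
have Dx : x = (z * y')%g by rewrite ez ey; gdeg.
have D1 : 1%g = (z * z')%g by rewrite ez'; gdeg.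
have Ez : z = z'^-1%g by rewrite ez' invgK.
(* then Delta(S a) = Delta(S a_1) (a_2 S(a_3) (x) 1) = S(a_2) (x) S(a_1) *)
have X (K : H y' -> H x' -> Z) (b : H x) : bilin K ->
    sw (fun (a1 : H z) (a2 : H y') => sw (fun p q => K (hm p a2) q) (antip H z z' a1)) b =
    K (hone y') (antip H x x' b).
  move=> hK.
  transitivity (sw (fun (e : H 1%g) (a4 : H x) => sw (fun (a1 : H z) (d : H z') =>
      sw (fun p q => K p (hm q (antip H x x' a4))) (hm (antip H z z' a1) d)) e) b).
    rewrite (sw_coA (t := y')) //; [|gdeg|lin_tac|lin_tac|lin_tac].
    apply: eq_sw => a1 b1.
    under [RHS]eq_sw => d a4.
      rewrite sw_mul //; last by lin_tac.
      rewrite sw_exchange.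
      under eq_sw => u' v' do under eq_sw => p q do rewrite -hmA.
      over.
    rewrite (sw_coA (t := 1%g)) //; [|rewrite ex; gdeg|lin_tac|lin_tac|lin_tac].
    under [RHS]eq_sw => a2 c.
      rewrite sw_exchange.
      under eq_sw => p q.
        rewrite (sw_antipr (F := fun r => K (hm p a2) (hm q r))) //; last by lin_tac.
        rewrite hm1r.
        over.
      rewrite -(sw_lin (F := fun r : Z => (heps c : k) *: r)); last by lin_tac.
      over.
    by rewrite (sw_counitr (F := fun r => sw (fun p q => K (hm p r) q) _)) //; lin_tac.
  under eq_sw => e a4.
    rewrite (sw_antipl (F := fun r => sw (fun p q => K p (hm q (antip H x x' a4))) r)) //;
      last by lin_tac.
    rewrite sw_one //; last by lin_tac.
    rewrite hm1l.
    over.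
  by rewrite (sw_counitl (F := fun r => K _ (antip H x x' r))) //; lin_tac.
transitivity (sw (fun (b : H x) (a3 : H y) => sw (fun (a1 : H z) (a2 : H y') =>
    sw (fun p q => F (hm (hm p a2) (antip H y y' a3)) q) (antip H z z' a1)) b) a).
  rewrite (sw_coA (t := 1%g)) //; [|rewrite ey; gdeg|lin_tac|lin_tac|lin_tac].
  under [RHS]eq_sw => a1 c.
    rewrite sw_exchange.
    under eq_sw => p q.
      under eq_sw => u v do rewrite -hmA.
      rewrite (sw_antipr (F := fun r => F (hm p r) q)) //; last by lin_tac.
      rewrite hm1r.
      over.
    rewrite -(sw_lin (F := fun r : Z => (heps c : k) *: r)); last by lin_tac.
    over.
  by rewrite (sw_counitr (F := fun r => sw F (antip H z z' r))) //; lin_tac.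
under eq_sw => b a3.
  rewrite (X (fun p q => F (hm p (antip H y y' a3)) q)) ?hm1l; last by lin_tac.
  over.
by [].
Qed.

Lemma eps_antip (a : H 1%g) : heps (antip H 1%g 1%g a) = heps a.
Proof.
have e : 1%g = 1^-1%g :> G by rewrite invg1.
have := sw_antipl (F := fun q : H 1%g => heps q) a e (lin_lfun heps (@lin_id _ _)).
under eq_sw => u v do rewrite hepsM mulrC.
rewrite (sw_counitr (F := fun q => heps (antip H _ _ q))); last by lin_tac.
by rewrite heps1 => ->; rewrite [LHS]mulr1.
Qed.

Variable g : pivot H.

Lemma sw_piv (Z : vectType k) x y z (b : H x -> H y -> Z) : z = (x * y)%g -> bilin b ->
  sw b (piv g z) = b (piv g x) (piv g y).
Proof.
by move=> ez hb; subst z; rewrite /sw /codelta comp_lfunE degcastxx piv_delta tlift_tensv.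
Qed.

(** The pivot is group-like, so S inverts it. *)
Lemma antip_piv x y : y = x^-1%g -> antip H x y (piv g x) = pivV g y.
Proof.
move=> e; have e' : x = y^-1%g by rewrite e invgK.
have D : 1%g = (x * y)%g by rewrite e mulgV.
have := sw_antipl (F := fun q : H y => hm q (pivV g y)) (piv g 1%g) e'.
rewrite sw_piv //; last by lin_tac.
rewrite piv_eps scale1r hm1l -hmA piv_mulV hm1r; apply.
by lin_tac.
Qed.

Lemma antip_pivV x y : y = x^-1%g -> antip H x y (pivV g x) = piv g y.
Proof.
move=> e.
have : hm (hm (antip H x y (pivV g x)) (pivV g y)) (piv g y) = piv g y.
  by rewrite -(antip_piv e) -antipM // piv_mulV antip1 // hm1l.
by rewrite -hmA piv_Vmul hm1r.
Qed.

Lemma antip_antip x y (a : H x) : y = x^-1%g ->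
  antip H y x (antip H x y a) = hm (hm (piv g x) a) (pivV g x).
Proof.
move=> e; subst y; rewrite -(piv_SS g) degcastE /antip !comp_lfunE degcastxx.
by [].
Qed.

End Antipode.

Section InverseAntipode.
Variables (G : groupType) (k : fieldType) (H : hopfGcoalg G k) (g : pivot H).
Implicit Types (x y z : G).

(** The inverse of the antipode, made explicit by S S(a) = g a g^-1. *)
Definition antipV x y : 'Hom(H x, H y) :=
  linfun (fun a => antip H x y (hm (hm (pivV g x) a) (piv g x))).

Lemma antipVE x y a : antipV x y a = antip H x y (hm (hm (pivV g x) a) (piv g x)).
Proof. by rewrite /antipV linE //; lin_tac. Qed.

Lemma antipVK x y (a : H x) : y = x^-1%g -> antipV y x (antip H x y a) = a.
Proof.
move=> e; have e' : x = y^-1%g by rewrite e invgK.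
rewrite antipVE !antipM // (antip_piv g e') (antip_pivV g e') (antip_antip g) //.
by rewrite !hmA piv_Vmul hm1l -hmA piv_Vmul hm1r.
Qed.

Lemma antipKV x y (a : H x) : y = x^-1%g -> antip H y x (antipV x y a) = a.
Proof.
move=> e; rewrite antipVE (antip_antip g) // !hmA piv_mulV hm1l.
by rewrite -hmA piv_mulV hm1r.
Qed.

Lemma antipVM x y (a b : H x) : y = x^-1%g ->
  antipV x y (hm a b) = hm (antipV x y b) (antipV x y a).
Proof.
move=> e; have e' : x = y^-1%g by rewrite e invgK.
by rewrite -[a in LHS](antipKV a e) -[b in LHS](antipKV b e) -(antipM _ _ e') antipVK.
Qed.

Lemma antipV1 x y : y = x^-1%g -> antipV x y (hone x) = hone y.
Proof.
by move=> e; rewrite antipVE hm1r piv_Vmul antip1.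
Qed.

Lemma sw_antipVl (Z : vectType k) x y (F : H x -> Z) (h : H 1%g) : y = x^-1%g -> lin F ->
  sw (fun (u : H x) (v : H y) => F (hm (antipV y x v) u)) h = (heps h : k) *: F (hone x).
Proof.
move=> e lF; have e' : x = y^-1%g by rewrite e invgK.
rewrite -(antipV1 e') -(sw_antipl (F := fun q : H y => F (antipV y x q)) h e'); last by lin_tac.
by apply: eq_sw => u v; rewrite antipVM // antipVK.
Qed.

Lemma sw_antipVr (Z : vectType k) x y (F : H x -> Z) (h : H 1%g) : y = x^-1%g -> lin F ->
  sw (fun (u : H y) (v : H x) => F (hm v (antipV y x u))) h = (heps h : k) *: F (hone x).
Proof.
move=> e lF; have e' : x = y^-1%g by rewrite e invgK.
rewrite -(antipV1 e') -(sw_antipr (F := fun q : H y => F (antipV y x q)) h e'); last by lin_tac.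
by apply: eq_sw => u v; rewrite antipVM // antipVK.
Qed.

End InverseAntipode.

(** * Twists by group-like functionals *)

Section Twists.
Variables (G : groupType) (k : fieldType) (H : hopfGcoalg G k) (nu : grouplike H).
Implicit Types (x y z : G).

Lemma RtwE x a : Rtw nu x a = sw (fun (u : H 1%g) (v : H x) => (nu u : k) *: v) a.
Proof.
rewrite /Rtw !comp_lfunE /sw /codelta comp_lfunE degcastE.
rewrite [in LHS](tens_tlift (hdelta _ _ _)).
rewrite [in LHS](lin_tlift (F := fun q => tlunit _ ((nu \oxf \1) q))); last by lin_tac.
by apply: eq_tlift => a1 v; rewrite tmapE id_lfunE tlunitE.
Qed.

Lemma LtwE x a : Ltw nu x a = sw (fun (u : H x) (v : H 1%g) => (nu v : k) *: u) a.
Proof.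
rewrite /Ltw !comp_lfunE /sw /codelta comp_lfunE degcastE.
rewrite [in LHS](tens_tlift (hdelta _ _ _)).
rewrite [in LHS](lin_tlift (F := fun q => trunit _ ((\1 \oxf nu) q))); last by lin_tac.
by apply: eq_tlift => a1 v; rewrite tmapE id_lfunE trunitE.
Qed.

Lemma gl_antipl (h : H 1%g) :
  sw (fun u v : H 1%g => nu (antip H 1%g 1%g u) * nu v : k^o) h = heps h.
Proof.
under eq_sw => u v do rewrite -gl_mul.
rewrite (sw_antipl (F := fun q : H 1%g => nu q)) ?invg1 //; last by lin_tac.
by rewrite gl_one [LHS]mulr1.
Qed.

(** As nu S is the convolution inverse of nu, R(nu S) is the inverse of R(nu). *)
Lemma Rtw_surj x (b : H x) :
  Rtw nu x (sw (fun (u : H 1%g) (v : H x) => (nu (antip H 1%g 1%g u) : k) *: v) b) = b.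
Proof.
rewrite RtwE (sw_lin (F := sw _)); last by lin_tac.
under eq_sw => u v.
  rewrite -RtwE linearZ /= RtwE (sw_lin (F := fun q : H x => (nu (antip H _ _ u) : k) *: q));
    last by lin_tac.
  over.
rewrite -(sw_coA (s := 1%g)) //; try gdeg; try by lin_tac.
under eq_sw => u v.
  under eq_sw => p q do rewrite scalerA.
  rewrite -(sw_lin (F := fun q : k^o => (q : k) *: v)); last by lin_tac.
  rewrite gl_antipl.
  over.
by rewrite (sw_counitl (F := fun q => q)).
Qed.

End Twists.

(** * Cointegrals and the Casimir element *)

Section Cointegral.
Variables (G : groupType) (k : fieldType) (H : hopfGcoalg G k) (g : pivot H).
Implicit Types (x y z : G).

(** As a_1 c (x) a_2 = c (x) a for a left cointegral c, both sides are the value of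
    b at a_1 c_1 (x) S(a_2 c_2) a_3. *)
Lemma casimir (Z : vectType k) x y (b : H x -> H x -> Z) (a : H x) (c : H 1%g) :
  y = x^-1%g -> bilin b -> left_cointegral c ->
  sw (fun (u : H x) (v : H y) => b (hm a u) (antip H y x v)) c =
  sw (fun (u : H x) (v : H y) => b u (hm (antip H y x v) a)) c.
Proof.
move=> e hb c_left; have e' : x = y^-1%g by rewrite e invgK.
have D : 1%g = (x * y)%g by rewrite e mulgV.
symmetry; pose K (q : H x) := sw (fun (u : H x) (v : H y) => b u (hm (antip H y x v) q)) c.
have lK : lin K by rewrite /K; lin_tac.
rewrite -[LHS]/(K a) -(sw_counitl (F := K)) //.
under eq_sw => a' a3.
  rewrite /K.
  rewrite -(linZ (f := sw (fun u v => b u (hm (antip H y x v) a3)))); last by lin_tac.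
  rewrite -c_left sw_mul //; last by lin_tac.
  under eq_sw => a1 a2 do under eq_sw => u v do rewrite antipM // -hmA.
  over.
rewrite (sw_coA (t := 1%g)) //; try by [gdeg | lin_tac | rewrite e; gdeg].
under eq_sw => a1 d.
  rewrite sw_exchange.
under eq_sw => u v do
    (rewrite (sw_antipl (F := fun q => b (hm a1 u) (hm (antip H y x v) q))) //; last by lin_tac).
  rewrite -(sw_lin (F := fun q => (heps d : k) *: q)); last by lin_tac.
  over.
rewrite (sw_counitr (F := fun q => sw (fun u v => b (hm q u) _) c)); last by lin_tac.
by apply: eq_sw => u v; rewrite hm1r.
Qed.

(** A left leg of the coproduct of c, read off through S so that [casimir] applies. *)
Definition leg (c : H 1%g) (om : 'Hom(H 1%g, k^o)) : H 1%g :=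
  sw (fun u v : H 1%g => (om (antip H 1%g 1%g v) : k) *: u) c.

Lemma lin_leg c : lin (leg c).
Proof. by rewrite /leg; lin_tac. Qed.

(** The legs of c form a left ideal, by the Casimir property. *)
Lemma leg_mul c om a : left_cointegral c ->
  hm a (leg c om) = leg c (om \o linfun (fun b => hm b a)).
Proof.
move=> c_left; rewrite /leg (sw_lin (F := hm a)); last by lin_tac.
under eq_sw => u v do rewrite (bilinZr _ _ _ (@hm_bilin _ _ _ _)).
rewrite (casimir (b := fun u v => (om v : k) *: u)) ?invg1 //; last by lin_tac.
by apply: eq_sw => u v; rewrite comp_lfunE linE //; lin_tac.
Qed.

(** The legs n = c_1 om(S c_2) also form a right coideal, so that
    eps(n) 1 = S^-1(n_2) n_1 is a leg again; it remains to choose om with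
    eps(n) = om(S c) = 1. *)
Lemma leg_eq_one (c : H 1%g) : c != 0 -> left_cointegral c -> exists om, leg c om = hone 1%g.
Proof.
move=> c0 c_left; have e1 : 1%g = 1^-1%g :> G by rewrite invg1.
pose F := linfun (leg c); have FE om : F om = leg c om by rewrite /F linE //; apply: lin_leg.
suff /memv_imgP[om _ ->] : hone 1%g \in limg F by exists om.
have ideal a n : n \in limg F -> hm a n \in limg F.
  case/memv_imgP => om _ ->; rewrite FE leg_mul // -FE; exact: memv_img (memvf _).
have [|om om1] := @exists_dual _ _ (antip H 1%g 1%g c).
  by apply: contraNneq c0 => Sc0; rewrite -(antipVK g c e1) Sc0 linear0.
have epsn : heps (leg c om) = 1.
  rewrite /leg (sw_lin (F := heps)); last by lin_tac.
  under eq_sw => u v do rewrite linearZ /= scalC.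
  by rewrite (sw_counitl (F := fun q => om (antip H _ _ q))) //; lin_tac.
rewrite -[hone _]scale1r -epsn.
rewrite -(sw_antipVl (F := fun q => q) g _ e1) // {1}/leg (sw_lin (F := sw _)); last by lin_tac.
(* eps(n) 1 = S^-1(c_2) om(S c_3) c_1: expand the second leg of c in a basis *)
pose E (q : H 1%g) : H 1%g := sw (fun u2 v : H 1%g =>
  (om (antip H 1%g 1%g v) : k) *: antipV g 1%g 1%g u2) q.
have lE : lin E by rewrite /E; lin_tac.
have -> : sw (fun (u v : H 1%g) => sw (fun u1 u2 : H 1%g => hm (antipV g 1%g 1%g u2) u1)
     ((om (antip H 1%g 1%g v) : k) *: u)) c = sw (fun u q => hm (E q) u) c.
  under [RHS]eq_sw => u q do
    (rewrite /E (sw_lin (F := fun q => hm q u)); last by lin_tac).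
  rewrite -(sw_coA (s := 1%g)) ?mulg1 //; try by lin_tac.
  apply: eq_sw => u v; rewrite linZ; last by lin_tac.
  rewrite (sw_lin (F := fun q : H 1%g => _ *: q)); last by lin_tac.
  by apply: eq_sw => u1 u2; rewrite (bilinZl _ _ _ (@hm_bilin _ _ _ _)).
have -> : sw (fun u q => hm (E q) u) c = \sum_(i < \dim {:H 1%g}) hm (E (vbasis {:H 1%g})`_i)
    (F (bcoord i \o antipV g 1%g 1%g)).
  transitivity (\sum_(i < \dim {:H 1%g}) sw (fun u q => hm (E (vbasis {:H 1%g})`_i)
      ((bcoord i q : k) *: u)) c).
    transitivity (sw (fun u q => \sum_(i < \dim {:H 1%g}) hm (E (vbasis {:H 1%g})`_i)
      ((bcoord i q : k) *: u)) c).
      apply: eq_sw => u q; rewrite {1}(bcoord_sum q) (lin_bigsum (f := fun q => hm (E q) u));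
        last by lin_tac.
      apply: eq_bigr => i _; rewrite linZ //.
      by rewrite (bilinZl _ _ _ (@hm_bilin _ _ _ _)) (bilinZr _ _ _ (@hm_bilin _ _ _ _)).
    exact: sw_sum.
  apply: eq_bigr => i _; rewrite -(sw_lin (F := hm _)); last by lin_tac.
  rewrite FE; congr hm; apply: eq_sw => u v.
  by rewrite comp_lfunE antipVK.
by apply: memv_suml => i _; apply: ideal; apply: memv_img; apply: memvf.
Qed.

(** Such an om is a Frobenius form: c_1 and om(S c_2 _) are dual bases of A. *)
Lemma leg_dual (c : H 1%g) om (a : H 1%g) : left_cointegral c -> leg c om = hone 1%g ->
  sw (fun u v : H 1%g => (om (hm (antip H 1%g 1%g v) a) : k) *: u) c = a.
Proof.
move=> c_left om1; rewrite -[RHS]hm1r -om1 leg_mul //.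
by apply: eq_sw => u v; rewrite comp_lfunE linE //; lin_tac.
Qed.

(** In the dual basis formula [leg_dual] for a = s a left cointegral, S(c_2)
    acts on s by a scalar, so s is a multiple of one fixed vector. *)
Lemma cointegral_uniq (c s : H 1%g) : c != 0 -> left_cointegral c -> left_cointegral s ->
  exists kappa : k, s = kappa *: c.
Proof.
move=> c0 c_left hs; have [om om1] := leg_eq_one c0 c_left.
pose e : H 1%g := sw (fun u v : H 1%g => (heps (antip H 1%g 1%g v) : k) *: u) c.
have E s' : left_cointegral s' -> s' = (om s' : k) *: e.
  move=> hs'; rewrite -[LHS](leg_dual s' c_left om1).
  rewrite /e (sw_lin (F := fun q : H 1%g => (om s' : k) *: q)); last by lin_tac.
  apply: eq_sw => u v; rewrite hs' linearZ /= scalerA mulrC.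
  by [].
have omc : (om c : k) != 0.
  by apply: contraNneq c0 => omc; rewrite (E c c_left) omc scale0r.
exists ((om s : k) / (om c : k)); rewrite [LHS](E s hs) [X in _ = _ *: X](E c c_left) scalerA.
by congr (_ *: _); rewrite divfK.
Qed.

End Cointegral.

Section Modulus.
Variables (G : groupType) (k : fieldType) (H : hopfGcoalg G k) (g : pivot H).
Variables (alpha : grouplike H) (c : H 1%g).
Hypothesis c0 : c != 0.
Hypothesis c_left : left_cointegral c.
Hypothesis ca : forall a : H 1%g, hm c a = (alpha a : k) *: c.
Implicit Types (x y z : G).

(** R(alpha) turns c, on which right multiplication acts by alpha, into a right
    cointegral. *)
Lemma Rtw_cointegral (b : H 1%g) :
  hm (Rtw alpha 1%g c) b = (heps b : k) *: Rtw alpha 1%g c.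
Proof.
rewrite -{1}(Rtw_surj alpha b) -RtwM ca linearZ /=; congr (_ *: _).
rewrite (sw_lin (F := alpha)); last by lin_tac.
by under eq_sw => u v do rewrite linearZ; exact: gl_antipl.
Qed.

Lemma antip_Rtw_cointegral : left_cointegral (antip H 1%g 1%g (Rtw alpha 1%g c)).
Proof.
have e : 1%g = 1^-1%g :> G by rewrite invg1.
move=> a; rewrite -{1}(antipKV g a e) -antipM // Rtw_cointegral linearZ /=; congr (_ *: _).
by rewrite -(eps_antip (antipV _ _ _ _)) antipKV.
Qed.

(** The Nakayama automorphism of the Casimir element: as S reverses the
    coproduct, the left side is c'_1 (x) S(c'_2) for the left cointegral
    c' = S(R(alpha) c) = kappa c. *)
Lemma nakayama : exists kappa : k, forall (Z : vectType k) x y (b : H x -> H x -> Z),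
  y = x^-1%g -> bilin b ->
  sw (fun (u : H x) (v : H y) =>
    b (antip H y x v) (hm (hm (piv g x) (Rtw alpha x u)) (pivV g x))) c =
  kappa *: sw (fun (u : H x) (v : H y) => b u (antip H y x v)) c.
Proof.
have [kappa hk] := cointegral_uniq g c0 c_left antip_Rtw_cointegral.
exists kappa => Z x y b e hb; have e' : x = y^-1%g by rewrite e invgK.
have e1 : 1%g = 1^-1%g :> G by rewrite invg1.
rewrite -(linZ (f := sw _)); last by lin_tac.
rewrite -hk (antipD (x := x) (y := y) (x' := y) (y' := x)) //; [|by rewrite e mulgV|by lin_tac].
rewrite RtwE (sw_lin (F := sw _)); last by lin_tac.
under [RHS]eq_sw => u v do (rewrite linZ; last by lin_tac).
under [RHS]eq_sw => u v do
  (rewrite (sw_lin (F := fun q : Z => (alpha u : k) *: q)); last by lin_tac).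
rewrite -(sw_coA (s := x)) ?mul1g //; try by [lin_tac | rewrite e; gdeg].
apply: eq_sw => u v; rewrite -(antip_antip g _ e) RtwE !(sw_lin (F := antip H _ _)); try by lin_tac.
rewrite (sw_lin (F := b _)); last by lin_tac.
apply: eq_sw => p q. rewrite !linearZ /= (bilinZr _ _ _ hb) //.
Qed.

End Modulus.

(** * Traces and partial traces of linear maps *)

Section LinearTrace.
Variable k : fieldType.
Implicit Types U V W P Q : vectType k.

Definition lftrace U (f : 'End(U)) : k^o := \sum_(i < \dim {:U}) bcoord i (f (vbasis {:U})`_i).

Lemma lin_lftrace U : lin (@lftrace U).
Proof. by rewrite /lftrace; lin_tac. Qed.

(** The trace can be computed in any family of vectors and forms that resolves
    the identity, such as a product basis of a tensor product. *)
Lemma lftrace_frame U (J : finType) (x : J -> U) (om : J -> 'Hom(U, k^o)) (f : 'End(U)) :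
  (forall u, u = \sum_j (om j u : k) *: x j) -> lftrace f = \sum_j om j (f (x j)).
Proof.
move=> frame; rewrite /lftrace.
under eq_bigr => i _.
  rewrite [X in bcoord i X]frame linear_sum.
  over.
rewrite exchange_big; apply: eq_bigr => j _ /=.
rewrite {2}(bcoord_sum (x j)) !linear_sum; apply: eq_bigr => i _ /=.
by rewrite !linearZ /= scalC.
Qed.

Lemma lftrace_cyc U W (f : 'Hom(U, W)) (h : 'Hom(W, U)) : lftrace (h \o f) = lftrace (f \o h).
Proof.
rewrite /lftrace.
under eq_bigr => i _.
  rewrite comp_lfunE [X in h X]bcoord_sum !linear_sum.
  over.
rewrite exchange_big; apply: eq_bigr => j _ /=; rewrite comp_lfunE.
rewrite [X in f X]bcoord_sum !linear_sum; apply: eq_bigr => i _ /=.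
by rewrite !linearZ /= scalC.
Qed.

Lemma lftrace_nondeg U W (f : 'Hom(U, W)) : f != 0 -> exists h :
  'Hom(W, U), lftrace (h \o f) = 1.
Proof.
move=> f0; have [i fi] : exists i : 'I_(\dim {:U}), f (vbasis {:U})`_i != 0.
  apply/existsP; apply: contraNT f0; rewrite negb_exists => /forallP f0.
  apply/eqP/lfunP => u; rewrite zero_lfunE (bcoord_sum u) linear_sum big1 // => i _.
  by move: (f0 i); rewrite negbK linearZ /= => /eqP->; rewrite scaler0.
have [om omf] := exists_dual fi; set u := (vbasis _)`_i in fi omf.
pose h := linfun (fun w : W => (om w : k) *: u).
have hE w : h w = (om w : k) *: u by rewrite /h linE //; lin_tac.
exists h; rewrite lftrace_cyc /lftrace.
under eq_bigr => j _ do rewrite comp_lfunE hE linearZ linearZ /= scalC.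
by rewrite -omf [in RHS](bcoord_sum (f u)) linear_sum; apply: eq_bigr => j _; rewrite linearZ.
Qed.

Definition contract Q V (om : 'Hom(V, k^o)) : 'Hom(Q \ox V, Q) := trunit Q \o (\1 \oxf om).

Lemma contractE Q V (om : 'Hom(V, k^o)) (q : Q) v : contract Q om (q \oxv v) = (om v : k) *: q.
Proof. by rewrite comp_lfunE tmapE id_lfunE trunitE. Qed.

Definition tensr P V (v : V) : 'Hom(P, P \ox V) := linfun (fun p => p \oxv v).

Lemma tensrE P V (v : V) (p : P) : tensr P v p = p \oxv v.
Proof. by rewrite /tensr linE //; lin_tac. Qed.

Definition ptrace P Q V (F : 'Hom(P \ox V, Q \ox V)) : 'Hom(P, Q) :=
  \sum_(i < \dim {:V}) (contract Q (bcoord i) \o F \o tensr P (vbasis {:V})`_i).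

Lemma ptrace_comp P Q P' Q' V (a : 'Hom(P', P)) (b : 'Hom(Q, Q')) (F : 'Hom(P \ox V, Q \ox V)) :
  ptrace ((b \oxf \1) \o F \o (a \oxf \1)) = b \o ptrace F \o a.
Proof.
rewrite /ptrace comp_lfun_sumr comp_lfun_suml; apply: eq_bigr => i _.
have -> : b \o (contract Q (bcoord i) \o F \o tensr P (vbasis {:V})`_i) \o a =
    (b \o contract Q (bcoord i)) \o F \o (tensr P (vbasis {:V})`_i \o a) by rewrite !comp_lfunA.
have -> : b \o contract Q (bcoord i) = contract Q' (bcoord i) \o (b \oxf \1).
  by apply: tens_ext => q v; rewrite !comp_lfunE !tmapE !id_lfunE !trunitE linearZ.
have -> : tensr P (vbasis {:V})`_i \o a = (a \oxf \1) \o tensr P' (vbasis {:V})`_i.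
  by apply/lfunP => q; rewrite !comp_lfunE !tensrE tmapE id_lfunE.
by rewrite !comp_lfunA.
Qed.

Lemma lftrace_ptrace P V (F : 'End(P \ox V)) : lftrace (ptrace F) = lftrace F.
Proof.
pose om (ij : 'I_(\dim {:P}) * 'I_(\dim {:V})) : 'Hom(P \ox V, k^o) :=
  bcoord ij.1 \o contract P (bcoord ij.2).
pose x (ij : 'I_(\dim {:P}) * 'I_(\dim {:V})) : P \ox V :=
  (vbasis {:P})`_ij.1 \oxv (vbasis {:V})`_ij.2.
rewrite [RHS](@lftrace_frame _ _ x om).
  rewrite /lftrace -(pair_bigA _ (fun i j => om (i, j) (F (x (i, j))))) /=.
  apply: eq_bigr => i _; rewrite /ptrace sum_lfunE linear_sum; apply: eq_bigr => j _ /=.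
  by rewrite !comp_lfunE tensrE.
move=> u; rewrite -[LHS](id_lfunE u).
have <- : \sum_ij linfun (fun u => (om ij u : k) *: x ij) = \1.
  apply: tens_ext => p v; rewrite sum_lfunE id_lfunE [in RHS](bcoord_sum p) [in RHS](bcoord_sum v).
  rewrite (bilin_suml _ _ _ _ (tensv_bilin _ _)).
  under [RHS]eq_bigr => i _ do rewrite (bilin_sumr _ _ _ _ (tensv_bilin _ _)) scaler_sumr.
  rewrite pair_bigA; apply: eq_bigr => ij _ /=.
  rewrite linE; last by lin_tac.
  by rewrite scalerA /om comp_lfunE contractE linearZ /= mulrC.
by rewrite sum_lfunE; apply: eq_bigr => ij _; rewrite linE //; lin_tac.
Qed.

Lemma ptrace_cyc (V : vectType k) (P Q : vectType k) (F : 'Hom(P \ox V, Q \ox V)) (a : 'End(V)) :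
  ptrace ((\1 \oxf a) \o F) = ptrace (F \o (\1 \oxf a)).
Proof.
apply/lfunP => p; rewrite /ptrace !sum_lfunE.
pose X j i : Q := contract Q (bcoord j) (F (p \oxv (vbasis {:V})`_i)).
transitivity (\sum_(i < \dim {:V}) \sum_(j < \dim {:V})
  (bcoord i (a (vbasis {:V})`_j) : k) *: X j i).
  apply: eq_bigr => i _; rewrite comp_lfunE tensrE comp_lfunE comp_lfunE.
  rewrite /X; move: (F _) => t; rewrite {1}(tens_tlift t).
  rewrite (lin_tlift (F := fun t => contract Q (bcoord i) ((\1 \oxf a) t))); last by lin_tac.
  under [RHS]eq_bigr => j _.
    rewrite {1}(tens_tlift t) (lin_tlift (F := fun t => (_ : k) *: contract Q (bcoord j) t));
      last by lin_tac.
    over.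
  rewrite -tlift_sum; apply: eq_tlift => q v.
  rewrite tmapE id_lfunE contractE {1}(bcoord_sum v) !linear_sum scaler_suml.
  by apply: eq_bigr => j _; rewrite contractE scalerA !linearZ /= mulrC.
rewrite exchange_big; apply: eq_bigr => j _.
rewrite !comp_lfunE tensrE tmapE id_lfunE [X in p \oxv X]bcoord_sum.
rewrite (lin_bigsum (f := fun v => trunit Q ((\1 \oxf bcoord j) (F (p \oxv v)))));
  last by lin_tac.
apply: eq_bigr => i _; rewrite (linZ (f := fun v => trunit Q ((\1 \oxf bcoord j) (F (p \oxv v)))));
  last by lin_tac.
by rewrite /X !comp_lfunE.
Qed.

End LinearTrace.

Section PartialTrace.
Variables (G : groupType) (k : fieldType) (H : hopfGcoalg G k) (g : pivot H) (V : gmod H).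

Lemma coevE :
  coev V (1 : k^o) = \sum_(i < \dim {:V}) (vbasis {:V})`_i \oxv (bcoord i : dualv V).
Proof. by rewrite /coev linE ?scale1r //; lin_tac. Qed.

Lemma evtE (v : V) (xi : dualv V) : evt g V (v \oxv xi) = fun_of_lfun xi (piv_act g V v).
Proof. by rewrite /evt tlift_tensv //; lin_tac. Qed.

Lemma trunitVE (U : vectType k) (u : U) : trunitV U u = u \oxv (1 : k^o).
Proof. by rewrite /trunitV linE //; lin_tac. Qed.

Lemma rptraceE (P Q : vectType k) (f : 'Hom(P \ox V, Q \ox V)) :
  rptrace g f = ptrace ((\1 \oxf piv_act g V) \o f).
Proof.
apply/lfunP => p; rewrite /ptrace sum_lfunE /rptrace.
rewrite (comp_lfunE _ (trunitV P)) trunitVE (comp_lfunE _ (_ \oxf _)) tmapE id_lfunE coevE.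
rewrite (lin_bigsum (f := fun q => fun_of_lfun _ (p \oxv q))); last by lin_tac.
apply: eq_bigr => i _; rewrite comp_lfunE tassocVE !comp_lfunE tmapE id_lfunE tensrE.
move: (f _) => t; rewrite [t in LHS](tens_tlift t) [t in RHS](tens_tlift t).
rewrite (lin_tlift (F := fun t => trunit Q ((\1 \oxf evt g V) (tassoc _ _ _ (t \oxv _)))));
  last by lin_tac.
rewrite (lin_tlift (F := fun t => trunit Q ((\1 \oxf bcoord i) ((\1 \oxf piv_act g V) t))));
  last by lin_tac.
apply: eq_tlift => q v; rewrite tassocE !tmapE !id_lfunE evtE.
by [].
Qed.

End PartialTrace.

(** * Homogeneous vectors of graded modules *)

Section Homogeneous.
Variables (G : groupType) (k : fieldType) (H : hopfGcoalg G k).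
Implicit Types (x y z : G) (V W : gmod H).

Definition homog V x (v : V) : Prop := gact V x (hone x) v = v.

Lemma gactMv V x (a b : H x) (v : V) : gact V x a (gact V x b v) = gact V x (hm a b) v.
Proof. by rewrite gactM comp_lfunE. Qed.

Lemma homog_gact V x (a : H x) (v : V) : homog x (gact V x a v).
Proof. by rewrite /homog gactMv hm1l. Qed.

Lemma gact_homog0 V x y (a : H y) (v : V) : homog x v -> y != x -> gact V y a v = 0.
Proof. by move=> <- yx; rewrite -comp_lfunE gact_orth // zero_lfunE. Qed.

Lemma homog_sum V (v : V) : v = \sum_(x <- gsupp V) gact V x (hone x) v.
Proof. by rewrite -[LHS](id_lfunE v) -(gact1 V) sum_lfunE. Qed.

Lemma homog_ext V (Z : vectType k) (f h : 'Hom(V, Z)) :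
  (forall x v, homog x v -> f v = h v) -> f = h.
Proof.
move=> E; apply/lfunP => v; rewrite (homog_sum v) !linear_sum; apply: eq_bigr => x _.
exact/E/homog_gact.
Qed.

Lemma homog_tens_ext V W (Z : vectType k) (f h : 'Hom(V \ox W, Z)) :
  (forall x y v w, homog x v -> homog y w -> f (v \oxv w) = h (v \oxv w)) -> f = h.
Proof.
move=> E; apply: tens_ext => v w.
pose f1 (u : V) : 'Hom(W, Z) := linfun (fun w => f (u \oxv w)).
pose h1 (u : V) : 'Hom(W, Z) := linfun (fun w => h (u \oxv w)).
have f1E u w' : f1 u w' = f (u \oxv w') by rewrite /f1 linE //; lin_tac.
have h1E u w' : h1 u w' = h (u \oxv w') by rewrite /h1 linE //; lin_tac.
pose f2 := linfun f1; pose h2 := linfun h1.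
have f2E : f2 =1 f1.
  by apply: linE => c u u'; apply/lfunP => w'; rewrite add_lfunE scale_lfunE !f1E;
    rewrite (proj1 (tensv_bilin _ _)) linearP.
have h2E : h2 =1 h1.
  by apply: linE => c u u'; apply/lfunP => w'; rewrite add_lfunE scale_lfunE !h1E;
    rewrite (proj1 (tensv_bilin _ _)) linearP.
rewrite -f1E -h1E -f2E -h2E; congr (fun_of_lfun _ _); congr (fun_of_lfun _ _).
apply: (@homog_ext V) => x u hu; rewrite f2E h2E.
by apply: (@homog_ext W) => y w' hw; rewrite f1E h1E (E x y).
Qed.

Lemma supp_sum V (W : vectType k) x v (F : G -> 'Hom(V, W)) : homog x v ->
  (forall y, y != x -> F y v = 0) -> (\sum_(y <- gsupp V) F y) v = F x v.
Proof.
move=> hv F0; rewrite sum_lfunE; have [xV|xV] := boolP (x \in gsupp V).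
  by rewrite (bigD1_seq x) ?gsupp_uniq //= big1 ?addr0.
have v0 : v = 0 by rewrite -hv gact_nsupp // zero_lfunE.
by rewrite v0 linear0 big1 // => i _; rewrite linear0.
Qed.

Lemma gmod_homP V W (f : 'Hom(V, W)) :
  (forall x v (a : H x), homog x v -> f (gact V x a v) = gact W x a (f v)) -> gmod_hom f.
Proof.
move=> hf y a; apply: (@homog_ext V) => x v hv; rewrite !comp_lfunE.
have [exy|yx] := eqVneq x y; first by subst y; apply: hf.
rewrite (gact_homog0 _ hv) 1?eq_sym // linear0 -hv hf //.
by rewrite (gact_homog0 _ (homog_gact _ _)) // eq_sym.
Qed.

Lemma gmod_homE V W (f : 'Hom(V, W)) x (a : H x) v : gmod_hom f ->
  f (gact V x a v) = gact W x a (f v).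
Proof. by move=> hf; rewrite -!comp_lfunE hf. Qed.

Lemma gmod_hom_comp (U : gmod H) V W (f : 'Hom(V, W)) (h : 'Hom(U, V)) :
  gmod_hom f -> gmod_hom h -> gmod_hom (f \o h).
Proof. by move=> hf hh x a; rewrite -comp_lfunA hh comp_lfunA hf comp_lfunA. Qed.

Lemma gmod_hom_id V : gmod_hom (\1 : 'Hom(V, V)).
Proof. by move=> x a; rewrite comp_lfun1l comp_lfun1r. Qed.

Lemma homog_hom V W (f : 'Hom(V, W)) x v : gmod_hom f -> homog x v -> homog x (f v).
Proof. by move=> hf hv; rewrite /homog -gmod_homE // hv. Qed.

Lemma tens_act_atE V W x z (h : H z) (v : V) (w : W) :
  tens_act_at V W x z h (v \oxv w) =
  sw (fun (a : H x) (b : H (x^-1 * z)%g) => gact V x a v \oxv gact W (x^-1 * z)%g b w) h.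
Proof.
rewrite /tens_act_at !comp_lfunE degcastE /sw /codelta comp_lfunE.
rewrite {1}(tens_tlift (hdelta _ _ _)).
rewrite (lin_tlift (F := fun q => tact (gact V x) (gact W _) q (v \oxv w)));
  last by lin_tac.
by apply: eq_tlift => a b; rewrite tactE tmapE.
Qed.

(** Only one factor has to be homogeneous: in the degree z = xy the summand
    V_x (x) W_y is determined by either of x and y.  The version for W,
    [gtensEr], serves to evaluate th (x) id for an arbitrary linear map th. *)
Lemma gtensEl V W x y z (h : H z) (v : V) (w : W) : z = (x * y)%g -> homog x v ->
  gact (gtens V W) z h (v \oxv w) =
  sw (fun (a : H x) (b : H y) => gact V x a v \oxv gact W y b w) h.
Proof.
move=> e hv; rewrite [LHS]/= tens_actE sum_lfunE.
pose F t : 'Hom(V, V \ox W) := tens_act_at V W t z h \o tensr V w.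
have FE t u : F t u = tens_act_at V W t z h (u \oxv w) by rewrite comp_lfunE tensrE.
under eq_bigr => t _ do rewrite -FE.
rewrite -sum_lfunE (supp_sum hv) => [|t tx].
  by rewrite FE tens_act_atE; have ey : y = (x^-1 * z)%g by [rewrite e mulKg]; subst y.
rewrite FE tens_act_atE sw0 // => a b.
by rewrite (gact_homog0 _ hv tx) (bilin0l _ (tensv_bilin _ _)).
Qed.

Lemma gtensEr V W x y z (h : H z) (v : V) (w : W) : z = (x * y)%g -> homog y w ->
  gact (gtens V W) z h (v \oxv w) =
  sw (fun (a : H x) (b : H y) => gact V x a v \oxv gact W y b w) h.
Proof.
move=> e hw; rewrite [LHS]/= tens_actE sum_lfunE.
have t0 (u : V) : u \oxv (0 : W) = 0 by rewrite (lin0 (f := fun w => u \oxv w)) //; lin_tac.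
have E t : t != x -> tens_act_at V W t z h (v \oxv w) = 0.
  move=> tx; rewrite tens_act_atE sw0 // => a b; rewrite (gact_homog0 _ hw) ?t0 //.
  by apply: contraNneq tx => tz; apply/eqP/(mulIg y); rewrite -e -tz mulVKg.
have ey : y = (x^-1 * z)%g by [rewrite e mulKg]; subst y.
rewrite -tens_act_atE; have [xV|xV] := boolP (x \in gsupp V).
  by rewrite (bigD1_seq x) ?gsupp_uniq //= big1 ?addr0.
rewrite big_seq big1 => [|t tV]; last by apply: E; apply: contraNneq xV => <-.
rewrite tens_act_atE sw0 // => a b.
by rewrite gact_nsupp // zero_lfunE (bilin0l _ (tensv_bilin _ _)).
Qed.

Lemma homog_tens V W x y z (v : V) (w : W) : z = (x * y)%g -> homog x v -> homog y w ->
  homog (V := gtens V W) z (v \oxv w).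
Proof.
move=> e hv hw; rewrite /homog (gtensEl _ _ e hv) sw_one //; last by lin_tac.
by rewrite hv hw.
Qed.

End Homogeneous.

(** * Averaging linear maps over a cointegral *)

Section Average.
Variables (G : groupType) (k : fieldType) (H : hopfGcoalg G k).
Implicit Types (x y z : G) (V W : gmod H).

(** The action of H_1 on the internal Hom of V and W, on vectors of degree x. *)
Definition homact_at V W x (a : H 1%g) (th : 'Hom(V, W)) : 'Hom(V, W) :=
  sw (fun (u : H x) (v : H x^-1%g) => gact W x u \o th \o gact V x (antip H x^-1%g x v)) a.

Definition homact V W (a : H 1%g) (th : 'Hom(V, W)) : 'Hom(V, W) :=
  \sum_(x <- gsupp V) homact_at x a th.

Lemma lin_homactl V W (th : 'Hom(V, W)) : lin (fun a => homact a th).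
Proof. by rewrite /homact /homact_at; lin_tac. Qed.

Lemma lin_homactr V W a : lin (@homact V W a).
Proof. by rewrite /homact /homact_at; lin_tac. Qed.

Lemma homact_atE V W x y (a : H 1%g) (th : 'Hom(V, W)) v : y = x^-1%g ->
  homact_at x a th v =
  sw (fun (u : H x) (u' : H y) => gact W x u (th (gact V x (antip H y x u') v))) a.
Proof.
move=> e; subst y; rewrite /homact_at (sw_lin (F := fun f : 'Hom(V, W) => f v));
  last by lin_tac.
by apply: eq_sw => u u'; rewrite !comp_lfunE.
Qed.

Lemma homactE V W x y (a : H 1%g) (th : 'Hom(V, W)) v : y = x^-1%g -> homog x v ->
  homact a th v = sw (fun (u : H x) (u' : H y) => gact W x u (th (gact V x (antip H y x u') v))) a.
Proof.
move=> e hv; rewrite /homact (supp_sum hv) ?(homact_atE _ _ _ e) // => t tx.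
rewrite (homact_atE _ _ _ erefl) sw0 // => u u'.
by rewrite (gact_homog0 _ hv) // !linear0.
Qed.

Lemma homact_mul V W (a b : H 1%g) (th : 'Hom(V, W)) :
  homact (hm a b) th = homact a (homact b th).
Proof.
apply: (@homog_ext _ _ _ V) => x v hv.
rewrite !(homactE _ _ erefl hv) sw_mul ?mulgV //; last by lin_tac.
apply: eq_sw => u u'; rewrite (homactE _ _ erefl (homog_gact _ _)).
rewrite (sw_lin (F := gact W x u)); last by lin_tac.
by apply: eq_sw => w w'; rewrite !gactMv antipM // invgK.
Qed.

Lemma homact_compr V W (U : gmod H) (f : 'Hom(U, V)) (a : H 1%g) (th : 'Hom(V, W)) :
  gmod_hom f -> homact a (th \o f) = homact a th \o f.
Proof.
move=> hf; apply: (@homog_ext _ _ _ U) => x v hv; rewrite comp_lfunE.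
rewrite (homactE _ _ erefl hv) (homactE _ _ erefl (homog_hom hf hv)).
by apply: eq_sw => u u'; rewrite comp_lfunE gmod_homE.
Qed.

Lemma homact_compl V W (U : gmod H) (f : 'Hom(W, U)) (a : H 1%g) (th : 'Hom(V, W)) :
  gmod_hom f -> homact a (f \o th) = f \o homact a th.
Proof.
move=> hf; apply: (@homog_ext _ _ _ V) => x v hv; rewrite comp_lfunE.
rewrite !(homactE _ _ erefl hv) (sw_lin (F := f)); last by lin_tac.
by apply: eq_sw => u u'; rewrite comp_lfunE -gmod_homE.
Qed.

(** The Casimir property, read as an identity of operators. *)
Lemma homact_hom V W (c : H 1%g) (th : 'Hom(V, W)) : left_cointegral c ->
  gmod_hom (homact c th).
Proof.
move=> c_left; apply: gmod_homP => x v a hv.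
rewrite (homactE _ _ erefl (homog_gact _ _)) (homactE _ _ erefl hv).
rewrite (sw_lin (F := gact W x a)); last by lin_tac.
under [RHS]eq_sw => u u' do rewrite gactMv.
rewrite (casimir (b := fun p q => gact W x p (th (gact V x q v)))) //; last by lin_tac.
by apply: eq_sw => u u'; rewrite gactMv.
Qed.

(** As S reverses the coproduct, a sends th (x) id to a_1 th S(a_4) (x) a_2 S(a_3),
    in which the second factor cancels. *)
Lemma homact_tens V W (U : gmod H) (a : H 1%g) (th : 'Hom(V, W)) :
  homact (V := gtens V U) (W := gtens W U) a (th \oxf \1) = homact a th \oxf \1.
Proof.
apply: homog_tens_ext => x y v w hv hw.
have hvw := homog_tens erefl hv hw.
set z := (x * y)%g in hvw.
have ez : z^-1%g = (y^-1 * x^-1)%g by rewrite /z invgM.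
rewrite (homactE _ _ erefl hvw) tmapE id_lfunE.
transitivity (sw (fun (e : H x) (w2 : H x^-1%g) =>
   gact W x e (th (gact V x (antip H x^-1%g x w2) v)) \oxv w) a); last first.
  by rewrite (homactE _ _ erefl hv) (sw_lin (F := fun q => q \oxv w)) //; lin_tac.
under eq_sw => u u'.
  rewrite (gtensEl _ _ erefl hv) (antipD (x := y^-1%g) (y := x^-1%g)) ?invgK //; last by lin_tac.
  rewrite (sw_lin (F := fun q => gact (gtens W U) z u ((th \oxf \1) q))); last by lin_tac.
  under eq_sw => w1 w2 do rewrite tmapE id_lfunE (gtensEr _ _ erefl (homog_gact _ _)).
  over.
rewrite -(sw_coA (s := x)) //; try by [lin_tac | rewrite /z; gdeg].
apply: eq_sw => e w2; rewrite (sw_coA (t := 1%g)) //; try by [lin_tac | rewrite /z; gdeg].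
under eq_sw => u1 d.
  under eq_sw => u2 w1 do rewrite gactMv.
  rewrite (sw_antipr (F := fun q => _ \oxv gact U y q w)) //; last by lin_tac.
  rewrite hw.
  over.
by rewrite (sw_counitr (F := fun q => gact W x q _ \oxv w)) //; lin_tac.
Qed.

End Average.

Section Regular.
Variables (G : groupType) (k : fieldType) (H : hopfGcoalg G k).
Implicit Types (x y z : G).

(** The regular module is concentrated in degree 1, where [degcast] is not 0. *)
Definition reg_act x : 'Hom(H x, 'End(H 1%g)) :=
  linfun (fun a => linfun (fun b => hm (degcast H x 1%g a) b)).

Lemma reg_actE x (a : H x) (b : H 1%g) : reg_act x a b = hm (degcast H x 1%g a) b.
Proof.
have E (a' : H x) (b' : H 1%g) :
    linfun (fun b => hm (degcast H x 1%g a') b) b' = hm (degcast H x 1%g a') b'.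
  by rewrite linE //; lin_tac.
rewrite /reg_act linE // => c u v; apply/lfunP => b'.
by rewrite add_lfunE scale_lfunE !E linearP (proj1 (@hm_bilin _ _ _ _)).
Qed.

Lemma degcast0 x y (a : H x) : x != y -> degcast H x y a = 0.
Proof. by move=> /eqP xy; rewrite /degcast; case: eqP => // _; rewrite zero_lfunE. Qed.

Lemma degcastM x y (a b : H x) :
  degcast H x y (hm a b) = hm (degcast H x y a) (degcast H x y b).
Proof.
have [exy|xy] := eqVneq x y; first by subst y; rewrite !degcastxx.
by rewrite !degcast0 // (bilin0l _ (@hm_bilin _ _ _ _)).
Qed.

Lemma reg_actM x (a b : H x) : reg_act x (hm a b) = reg_act x a \o reg_act x b.
Proof. by apply/lfunP => u; rewrite comp_lfunE !reg_actE degcastM hmA. Qed.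

Lemma reg_act_orth x y (a : H x) (b : H y) : x != y -> reg_act x a \o reg_act y b = 0.
Proof.
have hm0l (u : H 1%g) : hm 0 u = 0 by rewrite (bilin0l _ (@hm_bilin _ _ _ _)).
move=> xy; apply/lfunP => u; rewrite comp_lfunE zero_lfunE !reg_actE.
have [x1|x1] := eqVneq x 1%g; last by rewrite degcast0.
rewrite [degcast H y _ _]degcast0 -?x1 1?eq_sym // hm0l (lin0 (f := fun q => hm _ q)) //.
by lin_tac.
Qed.

Lemma reg_act1 : \sum_(x <- [:: 1%g]) reg_act x (hone x) = \1.
Proof. by rewrite big_seq1; apply/lfunP => u; rewrite reg_actE degcastxx hm1l id_lfunE. Qed.

Definition regmod : gmod H := GMod reg_actM reg_act_orth (erefl : uniq [:: 1%g]) reg_act1.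

Lemma regmodE x (a : H x) (b : regmod) : gact regmod x a b = hm (degcast H x 1%g a) b.
Proof. exact: reg_actE. Qed.

Lemma regmod1E (a : H 1%g) (b : regmod) : gact regmod 1%g a b = hm a b.
Proof. by rewrite regmodE degcastxx. Qed.

Lemma homog_regmod (b : regmod) : homog 1%g b.
Proof. by rewrite /homog regmod1E hm1l. Qed.

Lemma gmod_hom_regP (V : gmod H) (f : 'Hom(regmod, V)) :
  (forall a b : H 1%g, f (hm a b) = gact V 1%g a (f b)) -> gmod_hom f.
Proof.
move=> hf; apply: gmod_homP => x v a hv; have [x1|x1] := eqVneq x 1%g.
  by subst x; rewrite regmod1E hf.
have -> : v = 0 by rewrite -hv (gact_homog0 _ (homog_regmod v)).
by rewrite !linear0.
Qed.

Definition cproj (P : gmod H) : 'Hom(gtens regmod P, P) := tlunit P \o (heps \oxf \1).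

Lemma cprojE (P : gmod H) (a : regmod) (p : P) : cproj P (a \oxv p) = (heps a : k) *: p.
Proof. by rewrite comp_lfunE tmapE id_lfunE tlunitE. Qed.

Lemma cproj_hom (P : gmod H) : gmod_hom (cproj P).
Proof.
move=> z a; apply: (@tens_ext _ regmod P) => b p.
rewrite (comp_lfunE (cproj P)) (comp_lfunE _ (cproj P)).
rewrite (gtensEl _ _ (esym (mul1g z)) (homog_regmod b)).
rewrite (sw_lin (F := cproj P)); last by lin_tac.
rewrite cprojE linearZ /=.
under eq_sw => u v.
  rewrite cprojE regmod1E hepsM mulrC -scalerA.
  over.
rewrite -(sw_lin (F := fun q : P => (heps b : k) *: q)); last by lin_tac.
by rewrite (sw_counitl (F := fun q => gact P z q p)) //; lin_tac.
Qed.

Lemma cproj_onto (P : gmod H) : limg (cproj P) = fullv.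
Proof.
apply/eqP; rewrite eqEsubv subvf; apply/subvP => p _.
have -> : p = cproj P ((hone 1%g : regmod) \oxv p) by rewrite cprojE heps1 scale1r.
by rewrite memv_img ?memvf.
Qed.

End Regular.

Section Projective.
Variables (G : groupType) (k : fieldType) (H : hopfGcoalg G k) (g : pivot H).
Variable (c : H 1%g).
Hypothesis c0 : c != 0.
Hypothesis c_left : left_cointegral c.

Lemma regmod_avg : exists th : 'End(regmod H), homact c th = \1.
Proof.
have [om om1] := leg_eq_one g c0 c_left.
pose th : 'End(H 1%g) := linfun (fun a => (om a : k) *: hone 1%g).
have thE a : th a = (om a : k) *: hone 1%g by rewrite /th linE //; lin_tac.
exists th; apply/lfunP => a; rewrite (homactE _ _ (esym (invg1 G)) (homog_regmod a)) id_lfunE.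
rewrite -[RHS](leg_dual a c_left om1).
by apply: eq_sw => u v; rewrite !regmod1E thE (bilinZr _ _ _ (@hm_bilin _ _ _ _)) hm1r.
Qed.

(** The average of a linear lift of f th is a morphism that lifts f. *)
Lemma avg_projective (P : gmod H) (th : 'End(P)) : homact c th = \1 -> projective P.
Proof.
move=> avg M N e f he eonto hf.
exists (homact c (e^-1%VF \o f \o th)); first exact: homact_hom.
rewrite -homact_compl // !comp_lfunA.
have -> : e \o e^-1%VF = \1.
  by apply/lfunP => u; rewrite comp_lfunE id_lfunE limg_lfunVK // eonto memvf.
by rewrite comp_lfun1l homact_compl // avg comp_lfun1r.
Qed.

(** P is a direct summand of A (x) P, where the average of th (x) id is known. *)
Lemma projective_avg (P : gmod H) : projective P -> exists th : 'End(P), homact c th = \1.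
Proof.
move=> hP; have [s hs es] := hP _ _ _ _ (@cproj_hom _ _ _ P) (cproj_onto P) (gmod_hom_id P).
have [th tha] := regmod_avg.
exists (cproj P \o (th \oxf \1 : 'End(gtens (regmod H) P)) \o s).
rewrite homact_compr // homact_compl; last exact: cproj_hom.
by rewrite homact_tens tha tmap1 comp_lfun1r.
Qed.

Lemma tens_projective (P V : gmod H) : projective P -> projective (gtens P V).
Proof.
case/projective_avg => th tha; apply: (@avg_projective (gtens P V) (th \oxf \1)).
by rewrite homact_tens tha tmap1.
Qed.

Lemma reg_projective : projective (regmod H).
Proof. by have [th] := regmod_avg; apply: avg_projective. Qed.

Lemma retract_projective (P Q : gmod H) (i : 'Hom(P, Q)) (r : 'Hom(Q, P)) :
  gmod_hom i -> gmod_hom r -> r \o i = \1 -> projective Q -> projective P.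
Proof.
move=> hi hr ri hQ M N e f he eonto hf.
have [f' hf' ef'] := hQ M N e (f \o r) he eonto (gmod_hom_comp hf hr).
exists (f' \o i); first exact: gmod_hom_comp.
by rewrite comp_lfunA ef' -comp_lfunA ri comp_lfun1r.
Qed.

End Projective.

(** * The pivot and traces of twisted morphisms *)

Section PivotAction.
Variables (G : groupType) (k : fieldType) (H : hopfGcoalg G k) (g : pivot H).
Implicit Types (x y z : G) (V W P : gmod H).

Lemma piv_actE V x v : homog x v -> piv_act g V v = gact V x (piv g x) v.
Proof. by move=> hv; rewrite /piv_act (supp_sum hv) // => y; apply: gact_homog0. Qed.

Lemma pivV_actE V x v : homog x v -> pivV_act g V v = gact V x (pivV g x) v.
Proof. by move=> hv; rewrite /pivV_act (supp_sum hv) // => y; apply: gact_homog0. Qed.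

Lemma piv_actK V : pivV_act g V \o piv_act g V = \1.
Proof.
apply: (@homog_ext _ _ _ V) => x v hv; rewrite comp_lfunE id_lfunE (piv_actE hv).
by rewrite (pivV_actE (homog_gact _ _)) gactMv piv_Vmul.
Qed.

Lemma piv_actKV V : piv_act g V \o pivV_act g V = \1.
Proof.
apply: (@homog_ext _ _ _ V) => x v hv; rewrite comp_lfunE id_lfunE (pivV_actE hv).
by rewrite (piv_actE (homog_gact _ _)) gactMv piv_mulV.
Qed.

Lemma gact_piv V x (a : H x) : gact V x a \o piv_act g V = gact V x (hm a (piv g x)).
Proof.
apply: (@homog_ext _ _ _ V) => y v hv; rewrite comp_lfunE (piv_actE hv).
have [exy|xy] := eqVneq x y; first by subst y; rewrite gactMv.
by rewrite (gact_homog0 _ (homog_gact _ _)) // (gact_homog0 _ hv).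
Qed.

Lemma piv_gact V x (a : H x) : piv_act g V \o gact V x a = gact V x (hm (piv g x) a).
Proof.
apply: (@homog_ext _ _ _ V) => y v hv; rewrite comp_lfunE (piv_actE (homog_gact _ _)).
by rewrite gactMv.
Qed.

Lemma piv_act_tens V W : piv_act g (gtens V W) = piv_act g V \oxf piv_act g W.
Proof.
apply: homog_tens_ext => x y v w hv hw; have hvw := homog_tens erefl hv hw.
rewrite tmapE (piv_actE hvw) (gtensEl _ _ erefl hv) sw_piv //; last by lin_tac.
by rewrite (piv_actE hv) (piv_actE hw).
Qed.

Lemma piv_act_hom V W (f : 'Hom(V, W)) : gmod_hom f -> f \o piv_act g V = piv_act g W \o f.
Proof.
move=> hf; apply: (@homog_ext _ _ _ V) => y v hv; rewrite !comp_lfunE.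
by rewrite (piv_actE hv) gmod_homE // (piv_actE (homog_hom hf hv)).
Qed.

Lemma piv_act_neq0 V W (f : 'Hom(W, V)) : f != 0 -> piv_act g V \o f != 0.
Proof.
apply: contraNneq => pf0; rewrite -[f]comp_lfun1l -(piv_actK V) -comp_lfunA pf0.
by rewrite comp_lfun0r.
Qed.

Lemma neq0_piv_act V W (f : 'Hom(V, W)) : f != 0 -> f \o piv_act g V != 0.
Proof.
apply: contraNneq => pf0; rewrite -[f]comp_lfun1r -(piv_actKV V) comp_lfunA pf0.
by rewrite comp_lfun0l.
Qed.

(** The summands vanish outside the degrees of V, and of W. *)
Lemma homact_supp V W (a : H 1%g) (th : 'Hom(V, W)) :
  \sum_(x <- gsupp W) homact_at x a th = homact a th.
Proof.
apply: (@homog_ext _ _ _ V) => x v hv; rewrite /homact (supp_sum hv); last first.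
  move=> y yx; rewrite (homact_atE _ _ _ erefl) sw0 // => u u'.
  by rewrite (gact_homog0 _ hv) // !linear0.
have E y : y != x -> homact_at y a th v = 0.
  move=> yx; rewrite (homact_atE _ _ _ erefl) sw0 // => u u'.
  by rewrite (gact_homog0 _ hv) // !linear0.
rewrite sum_lfunE; have [xV|xV] := boolP (x \in gsupp W).
  by rewrite (bigD1_seq x) ?gsupp_uniq //= big1 ?addr0 // => y; apply: E.
rewrite big_seq big1 => [|t tV]; last by apply: E; apply: contraNneq xV => <-.
rewrite (homact_atE _ _ _ erefl) sw0 // => u u'.
by rewrite gact_nsupp // zero_lfunE.
Qed.

Section Twisted.
Variable nu : grouplike H.

Lemma twistE P x (a : H x) : gact (twist (Rendo nu) P) x a = gact P x (Rtw nu x a).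
Proof. by rewrite /= /twist_act comp_lfunE. Qed.

Lemma twist_homE (P P' : gmod H) (f : 'Hom(P', P)) :
  gmod_hom (f : 'Hom(P', twist (Rendo nu) P)) <->
  forall x (a : H x), f \o gact P' x a = gact P x (Rtw nu x a) \o f.
Proof. by split=> hf x a; have := hf x a; rewrite twistE. Qed.

(** f moves a_1 to R(nu)(a_1) = nu(a_1) a_2, and the factors S(a_3) g a_2 then
    cancel by cyclicity of the trace and g a = S S(a) g. *)
Lemma lftrace_homact (P P' : gmod H) (f : 'Hom(P', P)) (th : 'Hom(P, P')) a :
  gmod_hom (f : 'Hom(P', twist (Rendo nu) P)) ->
  lftrace (piv_act g P \o f \o homact a th) = nu a * lftrace (piv_act g P \o f \o th).
Proof.
move/twist_homE => hf; rewrite /homact (lin_bigsum (f := fun q => lftrace (piv_act g P \o f \o q)));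
  last first.
  by move=> c u v; rewrite (lin_compr _ (@lin_id _ _)) lin_lftrace.
pose Psi x b := lftrace (gact P x b \o (f \o th)).
have lPsi x : lin (Psi x).
  by move=> c u v; rewrite /Psi linearP (lin_compl _ (@lin_id _ _)) lin_lftrace.
transitivity (\sum_(x <- gsupp P) nu a * Psi x (piv g x)); last first.
  rewrite -mulr_sumr; congr (_ * _); rewrite -comp_lfunA /piv_act comp_lfun_suml.
  by rewrite (lin_bigsum _ _ _ (@lin_lftrace _ _)).
apply: eq_bigr => x _; have ey : x = x^-1^-1%g by rewrite invgK.
have lP := lPsi x.
rewrite /homact_at (sw_lin (F := fun q : 'Hom(P, P') => lftrace (piv_act g P \o f \o q)));
  last first.
  by move=> c u v; rewrite (lin_compr _ (@lin_id _ _)) lin_lftrace.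
transitivity (sw (fun (u : H x) (v : H x^-1%g) =>
    Psi x (hm (hm (antip H x^-1%g x v) (piv g x)) (Rtw nu x u))) a).
  apply: eq_sw => u v.
  have -> : piv_act g P \o f \o (gact P' x u \o th \o gact P x (antip H x^-1%g x v)) =
     (piv_act g P \o (f \o gact P' x u) \o th) \o gact P x (antip H x^-1%g x v).
     by rewrite !comp_lfunA.
  by rewrite lftrace_cyc hf !comp_lfunA gact_piv -gactM -!comp_lfunA.
under eq_sw => u v.
  rewrite RtwE (sw_lin (F := fun q => Psi x (hm _ q))); last by lin_tac.
  over.
rewrite (sw_coA (t := 1%g)) //; try by [gdeg | lin_tac].
under eq_sw => p d.
  under eq_sw => q v.
    rewrite (bilinZr _ _ _ (@hm_bilin _ _ _ _)) linZ //.
    have -> : hm (hm (antip H x^-1%g x v) (piv g x)) q =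
        hm (antip H x^-1%g x (hm (antip H x x^-1%g q) v)) (piv g x).
      by rewrite antipM // (antip_antip g) // -!hmA piv_Vmul hm1r.
    over.
  rewrite (sw_antipl (F := fun r => (nu p : k) *: Psi x (hm (antip H x^-1%g x r) (piv g x)))) //;
    last by lin_tac.
  rewrite antip1 // hm1l.
  over.
by rewrite (sw_counitr (F := fun q => (nu q : k) *: Psi x (piv g x))) //; lin_tac.
Qed.

End Twisted.

End PivotAction.

(** * The trace of the modulus *)

Section Canonical.
Variables (G : groupType) (k : fieldType) (H : hopfGcoalg G k) (g : pivot H).
Variables (nu : grouplike H) (c : H 1%g).
Hypothesis c0 : c != 0.
Hypothesis c_left : left_cointegral c.
Hypothesis ca : forall a : H 1%g, hm c a = (nu a : k) *: c.
Implicit Types (x y z : G) (V W P : gmod H).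

(** [nakayama] under the trace: an average on one side of a product can be moved
    to the other side. *)
Lemma nakayama_homact : exists kappa : k,
  forall (P P' : gmod H) (psi : 'Hom(P', P)) (th : 'Hom(P, P')),
  lftrace (piv_act g P \o (homact c (psi : 'Hom(P', twist (Rendo nu) P)) : 'Hom(P', P)) \o th) =
  kappa * lftrace (psi \o homact c th \o piv_act g P).
Proof.
have [kappa nak] := nakayama g c0 c_left ca; exists kappa => P P' psi th.
have cl (U1 U2 U3 : vectType k) (q : 'Hom(U1, U2)) :
  lin (fun r : 'Hom(U2, U3) => r \o q) by lin_tac.
have cr (U1 U2 U3 : vectType k) (q : 'Hom(U2, U3)) :
  lin (fun r : 'Hom(U1, U2) => q \o r) by lin_tac.
have lt U := @lin_lftrace k U.
rewrite -(homact_supp (V := P)) /homact.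
rewrite [in LHS]comp_lfun_sumr [in LHS]comp_lfun_suml [in LHS]lin_bigsum //.
rewrite [in RHS]comp_lfun_sumr [in RHS]comp_lfun_suml [in RHS]lin_bigsum // mulr_sumr.
apply: eq_bigr => x _.
pose b (p q : H x) : k^o := lftrace (psi \o gact P' x p \o th \o gact P x q \o piv_act g P).
have hb : bilin b.
  split=> d u v w; rewrite /b linearP.
    by rewrite cr !cl lt.
  by rewrite cr cl lt.
transitivity (sw (fun (u : H x) (v : H x^-1%g) =>
  b (antip H _ x v) (hm (hm (piv g x) (Rtw nu x u)) (pivV g x))) c).
  rewrite /homact_at (sw_lin (F := fun q => lftrace (piv_act g P \o q \o th))); last first.
    by move=> d u v; rewrite cr cl lt.
  apply: eq_sw => u v.
  transitivity (lftrace (piv_act g P \o (gact P x (Rtw nu x u) \o psi \o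
      gact P' x (antip H x^-1%g x v)) \o th)); first by rewrite twistE.
  rewrite !comp_lfunA piv_gact /b.
  rewrite -[RHS]/(lftrace (psi \o gact P' x (antip H x^-1 x v) \o th \o gact P x _ \o piv_act g P)).
  rewrite -[in RHS]comp_lfunA gact_piv -!hmA piv_Vmul hm1r.
  by rewrite -!comp_lfunA lftrace_cyc !comp_lfunA.
rewrite nak //; congr (_ * _).
rewrite (sw_lin (F := fun q => lftrace (psi \o q \o piv_act g P))); last first.
  by move=> d u v; rewrite cr cl lt.
by apply: eq_sw => u v; rewrite /b !comp_lfunA.
Qed.

(** Independence of the choice made in [can_trace]. *)
Lemma lftrace_eq_avg (P P' : gmod H) (f : 'Hom(P', P)) (th th' : 'Hom(P, P')) : projective P' ->
  gmod_hom (f : 'Hom(P', twist (Rendo nu) P)) -> homact c th = homact c th' ->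
  lftrace (piv_act g P \o f \o th) = lftrace (piv_act g P \o f \o th').
Proof.
move=> /(projective_avg g c0 c_left)[th0 avg0] hf E; have [kappa nak] := nakayama_homact.
have key q : lftrace (piv_act g P \o f \o q) =
    kappa * lftrace (f \o th0 \o homact c q \o piv_act g P).
  rewrite -nak; congr (lftrace (_ \o _ \o _)).
  by rewrite (homact_compl (V := P') (W := P') _ _ hf) avg0 comp_lfun1r.
by rewrite !key E.
Qed.

Lemma Rtw_hom : gmod_hom (Rtw nu 1%g : 'Hom(regmod H, twist (Rendo nu) (regmod H))).
Proof. by apply: gmod_hom_regP => a b; rewrite twistE regmod1E RtwM. Qed.

Lemma Rtw_neq0 : Rtw nu 1%g != 0.
Proof.
apply: contraTneq (oner_neq0 k) => R0.
by rewrite -(heps1 H) -(Rtw1 nu 1%g) R0 zero_lfunE linear0 eqxx.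
Qed.

(** If kappa were 0, then tr(g f th) = 0 for all f and th, hence f = 0; but R(nu)
    itself is a non-zero twisted endomorphism of the regular module. *)
Lemma nakayama_homact_neq0 : exists2 kappa : k, kappa != 0 &
  forall (P P' : gmod H) (psi : 'Hom(P', P)) (th : 'Hom(P, P')),
  lftrace (piv_act g P \o (homact c (psi : 'Hom(P', twist (Rendo nu) P)) : 'Hom(P', P)) \o th) =
  kappa * lftrace (psi \o homact c th \o piv_act g P).
Proof.
have [kappa nak] := nakayama_homact; exists kappa => //.
have [th0 avg0] := regmod_avg g c0 c_left.
have /lftrace_nondeg[h] := piv_act_neq0 g (V := regmod H) (W := regmod H) Rtw_neq0.
apply: contra_eq_neq => /= kappa0; rewrite lftrace_cyc.
have -> : Rtw nu 1%g = homact c (Rtw nu 1%g \o th0 : 'Hom(regmod H, twist (Rendo nu) (regmod H))).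
  by rewrite (homact_compl (V := regmod H) (W := regmod H) _ _ Rtw_hom) avg0 comp_lfun1r.
by rewrite (nak (regmod H) (regmod H)) kappa0 mul0r eq_sym oner_neq0.
Qed.

(** A canonical solution of the linear equation c.th = id, solvable exactly for
    projective P; this avoids any choice principle. *)
Definition avg_preim P : 'End(P) := ((linfun (@homact G k H P P c))^-1)%VF \1.

Lemma avg_preimE P : projective P -> homact c (avg_preim P) = \1.
Proof.
move=> /(projective_avg g c0 c_left)[th avg].
have E f : linfun (@homact G k H P P c) f = homact c f by rewrite linE //; apply: lin_homactr.
rewrite -E /avg_preim limg_lfunVK // -avg -E; exact: memv_img (memvf _).
Qed.

Definition can_trace : trace_family (Rendo nu) :=
  fun P f => lftrace (piv_act g P \o (f : 'Hom(P, P)) \o avg_preim P).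

Lemma can_traceE (P : gmod H) (f th : 'End(P)) : projective P ->
  gmod_hom (f : 'Hom(P, twist (Rendo nu) P)) -> homact c th = \1 ->
  can_trace (P := P) f = lftrace (piv_act g P \o f \o th).
Proof. by move=> hP hf avg; apply: lftrace_eq_avg => //; rewrite avg_preimE. Qed.

Lemma can_trace_right : right_module_trace g can_trace.
Proof.
split.
- move=> P d f f' _ _ _; rewrite /can_trace.
  have -> : piv_act g P \o (d *: f + f' : 'Hom(P, P)) \o avg_preim P =
    d *: (piv_act g P \o (f : 'Hom(P, P)) \o avg_preim P) +
    (piv_act g P \o (f' : 'Hom(P, P)) \o avg_preim P).
    have [_ b] := comp_lfun_bilin P P P; have [b' _] := comp_lfun_bilin P P P.
    by rewrite b b'.
  exact: lin_lftrace.
- move=> P P' h f hP hP' hh hf; rewrite /can_trace.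
  transitivity (lftrace (piv_act g P \o f \o (h \o avg_preim P))); first by rewrite !comp_lfunA.
  rewrite (lftrace_eq_avg hP' hf (th' := avg_preim P' \o h)); last first.
    by rewrite homact_compl // homact_compr // !avg_preimE // comp_lfun1l comp_lfun1r.
  by rewrite !comp_lfunA lftrace_cyc !comp_lfunA piv_act_hom.
move=> P V f hP hf.
rewrite (can_traceE (P := gtens P V) (th := avg_preim P \oxf \1)) //; last 2 first.
- exact: (tens_projective g c0 c_left).
- by rewrite homact_tens avg_preimE // tmap1.
rewrite /can_trace rptraceE -ptrace_comp lftrace_ptrace piv_act_tens; congr lftrace.
by rewrite !comp_lfunA tmap_comp comp_lfun1l comp_lfun1r.
Qed.

(** The average of a linear map h with tr(g f h) = 1. *)
Lemma can_trace_dual (P P' : gmod H) (f : 'Hom(P', P)) : projective P -> projective P' ->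
  gmod_hom (f : 'Hom(P', twist (Rendo nu) P)) -> f != 0 ->
  exists2 h : 'Hom(P, P'), gmod_hom h & lftrace (piv_act g P \o (f \o h) \o avg_preim P) = 1.
Proof.
move=> hP hP' hf f0; have [h] := lftrace_nondeg (piv_act_neq0 g (V := P) (W := P') f0).
rewrite lftrace_cyc => tr1; exists (homact c h); first exact: homact_hom.
rewrite comp_lfunA -comp_lfunA (lftrace_eq_avg hP' hf (th' := h)) //.
by rewrite homact_compl ?avg_preimE ?comp_lfun1r //; apply: homact_hom.
Qed.

(** Stated for any multiple of the canonical trace, to apply to all traces. *)
Lemma can_trace_nondegenerate (t : trace_family (Rendo nu)) (K : k) : K != 0 ->
  (forall (P : gmod H) (f th : 'End(P)), projective P ->
    gmod_hom (f : 'Hom(P, twist (Rendo nu) P)) -> homact c th = \1 ->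
    t P f = K * lftrace (piv_act g P \o f \o th)) ->
  trace_nondegenerate t.
Proof.
move=> K0 tE P P' hP hP'; split.
  move=> f hf f_perp; apply/eqP/contraT => f0.
  have [h hh tr1] := can_trace_dual hP hP' hf f0; have := f_perp h hh.
  rewrite (tE _ _ (avg_preim P)) ?avg_preimE //; last exact: gmod_hom_comp hf hh.
  by rewrite tr1 mulr1 => /eqP; rewrite (negPf K0).
move=> h hh h_perp; apply/eqP/contraT => h0.
have [kappa kappa0 nak] := nakayama_homact_neq0.
have [psi] := lftrace_nondeg (neq0_piv_act g h0); rewrite comp_lfunA => tr1.
have hf : gmod_hom (homact c (psi : 'Hom(P', twist (Rendo nu) P))) by apply: homact_hom.
have := h_perp _ hf; rewrite (tE _ _ (avg_preim P)) ?avg_preimE //; last exact: gmod_hom_comp hf hh.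
have -> : piv_act g P \o
    (homact c (psi : 'Hom(P', twist (Rendo nu) P)) \o h : 'Hom(P, P)) \o avg_preim P =
  piv_act g P \o homact c (psi : 'Hom(P', twist (Rendo nu) P)) \o (h \o avg_preim P).
  by rewrite !comp_lfunA.
rewrite nak homact_compl // avg_preimE // comp_lfun1r tr1 mulr1 => /eqP.
by rewrite mulf_eq0 (negPf K0) (negPf kappa0).
Qed.

Lemma can_trace_nonzero : trace_nonzero can_trace.
Proof.
have hA := reg_projective g c0 c_left.
have [h hh tr1] := can_trace_dual hA hA Rtw_hom Rtw_neq0.
exists (regmod H), (Rtw nu 1%g \o h); split=> //; first exact: gmod_hom_comp Rtw_hom hh.
by rewrite /can_trace tr1 oner_neq0.
Qed.

End Canonical.

Section LeftTwist.
Variables (G : groupType) (k : fieldType) (H : hopfGcoalg G k) (nu : grouplike H).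
Implicit Types (x y z : G).

Lemma gl_antipr (h : H 1%g) :
  sw (fun u v : H 1%g => nu u * nu (antip H 1%g 1%g v) : k^o) h = heps h.
Proof.
under eq_sw => u v do rewrite -gl_mul.
rewrite (sw_antipr (F := fun q : H 1%g => nu q)) ?invg1 //; last by lin_tac.
by rewrite gl_one [LHS]mulr1.
Qed.

Lemma Ltw_surj x (b : H x) :
  Ltw nu x (sw (fun (u : H x) (v : H 1%g) => (nu (antip H 1%g 1%g v) : k) *: u) b) = b.
Proof.
rewrite LtwE (sw_lin (F := sw _)); last by lin_tac.
under eq_sw => u v.
  rewrite -LtwE linearZ /= LtwE (sw_lin (F := fun q : H x => (nu (antip H _ _ v) : k) *: q));
    last by lin_tac.
  over.
rewrite (sw_coA (t := 1%g)) //; try gdeg; try by lin_tac.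
under eq_sw => u v.
  under eq_sw => p q do rewrite scalerA mulrC.
  rewrite -(sw_lin (F := fun q : k^o => (q : k) *: u)); last by lin_tac.
  rewrite gl_antipr.
  over.
by rewrite (sw_counitr (F := fun q => q)).
Qed.

(** This makes [reg_form] below a morphism to the twisted regular module. *)
Lemma Rtw_Ltw (b c : H 1%g) : left_cointegral c ->
  hm (Rtw nu 1%g b) (Ltw nu 1%g c) = (heps b : k) *: Ltw nu 1%g c.
Proof.
move=> c_left; rewrite -(Ltw_surj (Rtw nu 1%g b)) -LtwM c_left linearZ /=; congr (_ *: _).
rewrite (sw_lin (F := heps)); last by lin_tac.
under eq_sw => u v do rewrite linearZ /= scalC.
rewrite (sw_counitl (F := fun q => nu (antip H _ _ q))); last by lin_tac.
rewrite RtwE (sw_lin (F := fun q => nu (antip H _ _ q))); last by lin_tac.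
by under eq_sw => u v do rewrite !linearZ /=; apply: gl_antipr.
Qed.

End LeftTwist.

(** * Uniqueness of right module traces *)

Lemma twist_hom (G : groupType) (k : fieldType) (H : hopfGcoalg G k) (phi : algendo H)
    (V W : gmod H) (f : 'Hom(V, W)) :
  gmod_hom f -> gmod_hom (f : 'Hom(twist phi V, twist phi W)).
Proof. by move=> hf x a; rewrite /= /twist_act !comp_lfunE hf. Qed.

Lemma trace_linearZ (G : groupType) (k : fieldType) (H : hopfGcoalg G k) (phi : algendo H)
    (t : trace_family phi) (P : gmod H) (f : 'Hom(P, twist phi P)) (a : k) :
  trace_linear t -> projective P -> gmod_hom f -> t P (a *: f) = a * t P f.
Proof.
move=> tl hP hf.
have h0 : gmod_hom (0 : 'Hom(P, twist phi P)).
  by move=> x b; rewrite comp_lfun0l comp_lfun0r.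
have t0 : t P 0 = 0.
  by have := tl P (-1) 0 0 hP h0 h0; rewrite scaler0 addr0 mulN1r addNr.
by rewrite -[a *: f]addr0 tl // t0 addr0.
Qed.

Section General.
Variables (G : groupType) (k : fieldType) (H : hopfGcoalg G k) (g : pivot H).
Variables (nu : grouplike H) (c : H 1%g).
Hypothesis c0 : c != 0.
Hypothesis c_left : left_cointegral c.
Implicit Types (x y z : G) (V W P : gmod H).

Definition reg_form : 'End(H 1%g) := linfun (fun a => (heps a : k) *: Ltw nu 1%g c).

Lemma reg_formE a : reg_form a = (heps a : k) *: Ltw nu 1%g c.
Proof. by rewrite /reg_form linE //; lin_tac. Qed.

Lemma reg_form_hom : gmod_hom (reg_form : 'Hom(regmod H, twist (Rendo nu) (regmod H))).
Proof.
apply: gmod_hom_regP => a b; rewrite twistE regmod1E !reg_formE hepsM.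
by rewrite (bilinZr _ _ _ (@hm_bilin _ _ _ _)) Rtw_Ltw // scalerA mulrC.
Qed.

(** If c.th = id, its average is a section of the counit A (x) P -> P; through it
    traces on P are reduced to traces on A. *)
Definition reg_lift P (th : 'End(P)) : 'Hom(P, gtens (regmod H) P) :=
  linfun (fun p => (hone 1%g : regmod H) \oxv th p).

Lemma reg_liftE P (th : 'End(P)) p : reg_lift th p = (hone 1%g : regmod H) \oxv th p.
Proof. by rewrite /reg_lift linE //; lin_tac. Qed.

Lemma homact_reg_lift P (th : 'End(P)) p : homact c (reg_lift th) p =
  sw (fun u d : H 1%g => (u : regmod H) \oxv homact d th p) c.
Proof.
have lm (q : P) : lin (fun a => homact a th q).
  by move=> d u v; rewrite lin_homactl add_lfunE scale_lfunE.
pose R : 'Hom(P, gtens (regmod H) P) :=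
  linfun (fun p => sw (fun u d : H 1%g => (u : regmod H) \oxv homact d th p) c).
have RE q : R q = sw (fun u d : H 1%g => (u : regmod H) \oxv homact d th q) c.
  by rewrite /R linE //; lin_tac.
rewrite -RE; congr (fun_of_lfun _ _); apply: (@homog_ext _ _ _ P) => x v hv.
rewrite RE (homactE _ _ erefl hv).
under eq_sw => u u'.
  rewrite reg_liftE (gtensEl _ _ (esym (mul1g x)) (homog_regmod _)).
  under eq_sw => s t do rewrite regmod1E hm1r.
  over.
rewrite (sw_coA (t := 1%g)) //; try by [gdeg | lin_tac].
apply: eq_sw => u d; rewrite (homactE _ _ erefl hv).
by rewrite (sw_lin (F := fun q => (u : regmod H) \oxv q)) //; lin_tac.
Qed.

Lemma cproj_reg_lift P (th : 'End(P)) : cproj P \o reg_lift th = th.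
Proof. by apply/lfunP => p; rewrite comp_lfunE reg_liftE cprojE heps1 scale1r. Qed.

Lemma twist_piv_act P (f : 'End(P)) : gmod_hom (f : 'Hom(P, twist (Rendo nu) P)) ->
  f \o piv_act g P = (nu (piv g 1%g) : k) *: (piv_act g P \o f).
Proof.
move=> hf; apply: (@homog_ext _ _ _ P) => x v hv; rewrite comp_lfunE scale_lfunE comp_lfunE.
have hfv : homog x (f v : P).
  by have := gmod_homE (hone x) v hf; rewrite hv twistE Rtw1 => /esym.
rewrite (piv_actE g hv) (piv_actE g hfv) (gmod_homE _ _ hf) twistE RtwE sw_piv ?mul1g //.
  by rewrite linearZ scale_lfunE.
by lin_tac.
Qed.

(** The partial trace at a is eps(a) c_1 tr(g (c_2.th) f), and c_2 contributes
    nu(c_2) by [lftrace_homact]; the pivot costs nu(g) when moved past f. *)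
Lemma rptrace_reg P (f th : 'End(P)) : gmod_hom (f : 'Hom(P, twist (Rendo nu) P)) ->
  rptrace g (homact c (reg_lift th) \o f \o cproj P : 'Hom(regmod H \ox P, regmod H \ox P)) =
  ((nu (piv g 1%g) : k) * lftrace (piv_act g P \o f \o th)) *: reg_form.
Proof.
move=> hf; apply/lfunP => a; rewrite scale_lfunE reg_formE rptraceE /ptrace sum_lfunE.
pose W (d : H 1%g) : k^o := lftrace (piv_act g P \o homact d th \o f).
transitivity ((heps a : k) *: sw (fun u d : H 1%g => (W d : k) *: u) c).
  have E i : (contract (regmod H) (bcoord i) \o
       (\1 \oxf piv_act g P \o (homact c (reg_lift th) \o f \o cproj P)) \o
       tensr (regmod H) (vbasis {:P})`_i) a =
    (heps a : k) *: sw (fun u d : H 1%g =>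
      (bcoord i (piv_act g P (homact d th (f (vbasis {:P})`_i))) : k) *: u) c.
    move: (cproj P) (cprojE a (vbasis {:P})`_i) => C hC.
    rewrite !comp_lfunE tensrE hC !linearZ /= homact_reg_lift; congr (_ *: _).
    rewrite (sw_lin (F := fun q => trunit _ ((\1 \oxf bcoord i) ((\1 \oxf piv_act g P) q))));
      last by lin_tac.
    by apply: eq_sw => u d; rewrite !tmapE !id_lfunE trunitE.
  under eq_bigr => i _ do rewrite E.
  rewrite -scaler_sumr -sw_sum; congr (_ *: _); apply: eq_sw => u d.
  rewrite /W /lftrace -scaler_suml; congr (_ *: _); apply: eq_bigr => i _.
  by rewrite !comp_lfunE.
have WE d : W d = (nu (piv g 1%g) * lftrace (piv_act g P \o f \o th)) * nu d.
  rewrite /W lftrace_cyc comp_lfunA twist_piv_act //.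
  rewrite (bilinZl _ _ _ (comp_lfun_bilin P P P)).
  rewrite (linZ _ _ (@lin_lftrace _ _)) (lftrace_homact _ _ _ hf).
  by rewrite [in LHS]/GRing.scale /= mulrA mulrAC.
under eq_sw => u d do rewrite WE -scalerA.
rewrite -(sw_lin (F := fun q : H 1%g => (_ : k) *: q)); last by lin_tac.
by rewrite -LtwE !scalerA mulrC.
Qed.

(** Factor f through A (x) P, then use cyclicity and the partial trace property. *)
Lemma right_trace_formula (t : trace_family (Rendo nu)) : right_module_trace g t ->
  exists K : k, forall (P : gmod H) (f th : 'End(P)), projective P ->
    gmod_hom (f : 'Hom(P, twist (Rendo nu) P)) -> homact c th = \1 ->
    t P f = K * lftrace (piv_act g P \o f \o th).
Proof.
move=> [t_lin t_cyc t_tens].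
exists (nu (piv g 1%g) * t (regmod H) reg_form) => P f th hP hf avg.
have hA := reg_projective g c0 c_left; have hAP := tens_projective g c0 c_left (V := P) hA.
have hs : gmod_hom (homact c (reg_lift th)) by apply: homact_hom.
have es : cproj P \o homact c (reg_lift th) = \1.
  by rewrite -homact_compl ?cproj_reg_lift //; apply: cproj_hom.
have hfe : gmod_hom (f \o cproj P : 'Hom(gtens (regmod H) P, twist (Rendo nu) P)).
  exact: gmod_hom_comp hf (@cproj_hom _ _ _ P).
transitivity (t P ((f \o cproj P) \o homact c (reg_lift th))).
  by rewrite -comp_lfunA es comp_lfun1r.
rewrite t_cyc // t_tens //; last first.
  by apply: gmod_hom_comp hfe; apply: twist_hom.
rewrite comp_lfunA (rptrace_reg _ hf) (trace_linearZ _ t_lin hA reg_form_hom).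
by rewrite mulrAC.
Qed.

End General.

(** * Right module traces *)

Section RightTrace.
Variables (G : groupType) (k : fieldType) (H : hopfGcoalg G k) (g : pivot H).
Variables (alpha nu : grouplike H).
Hypothesis halpha : is_modulus alpha.

(** Compare the formula for th and for th + (a.th - alpha(a) th), which have the
    same average. *)
Lemma right_trace_modulus (t : trace_family (Rendo nu)) :
  right_module_trace g t -> trace_nonzero t -> gl_fun nu = gl_fun alpha.
Proof.
have [c [c0 c_left ca]] := halpha.
move=> /(right_trace_formula c0 c_left)[K tE] [P [f [hP hf tf0]]].
have [th avg] := projective_avg g c0 c_left hP.
apply/lfunP => a; apply/eqP; rewrite -subr_eq0.
pose th' := (homact a th - (alpha a : k) *: th) + th.
have avg' : homact c th' = \1.
  pose M q := homact c (q : 'End(P)); have lM : lin M by apply: lin_homactr.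
  rewrite -/(M th') /th' (linD (f := M)) // (linD (f := M)) // -scaleN1r !(linZ (f := M)) //.
  rewrite /M -homact_mul ca (linZ (f := fun b => homact b th)); last exact: lin_homactl.
  by rewrite scaleN1r subrr add0r.
pose L q := lftrace (piv_act g P \o (f : 'End(P)) \o q).
have lL : lin L.
  by move=> d u v; rewrite /L (lin_compr _ (@lin_id _ _)) lin_lftrace.
have LE : L th' = L th.
  apply: (@mulfI _ (K : k)).
    by apply: contraNneq tf0 => K0; rewrite (tE P f th) // K0 mul0r.
  by rewrite -!tE.
have Lth : L th != 0.
  by apply: contraNneq tf0 => L0; rewrite (tE P f th) // -/(L th) L0 mulr0.
move/eqP: LE; rewrite /th' (linD (f := L)) // -subr_eq0 addrK (linD (f := L)) //.
rewrite -scaleN1r !(linZ (f := L)) // /L lftrace_homact // scaleN1r.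
rewrite -[X in _ * X - _]/(L th) -[X in _ - _ *: X]/(L th) -[_ *: _]/(_ * _) -mulrBl.
by rewrite mulf_eq0 (negPf Lth) orbF.
Qed.

Lemma right_trace_exists : gl_fun nu = gl_fun alpha ->
  exists t : trace_family (Rendo nu), right_module_trace g t /\ trace_nonzero t.
Proof.
move=> enu; have [c [c0 c_left ca]] := halpha; rewrite -enu in ca.
by exists (can_trace g c); split; [exact: can_trace_right | exact: can_trace_nonzero].
Qed.

Lemma right_trace_nondegenerate (t : trace_family (Rendo nu)) :
  right_module_trace g t -> trace_nonzero t -> trace_nondegenerate t.
Proof.
move=> tr tn; have enu := right_trace_modulus tr tn.
have [c [c0 c_left ca]] := halpha; rewrite -enu in ca.
have [K tE] := right_trace_formula c0 c_left tr.
apply: (can_trace_nondegenerate (g := g) c0 c_left ca (K := K)) => //.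
have [P [f [hP hf tf0]]] := tn; have [th avg] := projective_avg g c0 c_left hP.
by apply: contraNneq tf0 => K0; rewrite (tE P f th) // K0 mul0r.
Qed.

End RightTrace.

(** * The co-opposite Hopf coalgebra *)

(** A copy of G that carries the opposite multiplication. *)
Definition opgroup (G : groupType) : Type := G.

Section OppositeGroup.
Variable G : groupType.

Definition op_mul (x y : opgroup G) : opgroup G := (y * x)%g.

Lemma op_mulA : associative op_mul.
Proof. by move=> x y z; rewrite /op_mul mulgA. Qed.

Lemma op_mul1g : left_id (1%g : G) op_mul.
Proof. by move=> x; apply: mulg1. Qed.

Lemma op_mulg1 : right_id (1%g : G) op_mul.
Proof. by move=> x; apply: mul1g. Qed.

Lemma op_mulVg : left_inverse (1%g : G) (@monoid.inv G) op_mul.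
Proof. by move=> x; apply: mulgV. Qed.

Lemma op_mulgV : right_inverse (1%g : G) (@monoid.inv G) op_mul.
Proof. by move=> x; apply: mulVg. Qed.

HB.instance Definition _ := Choice.copy (opgroup G) G.
HB.instance Definition _ := isGroup.Build (opgroup G) op_mulA op_mul1g op_mulg1 op_mulVg op_mulgV.

End OppositeGroup.

Section Flip.
Variable k : fieldType.
Implicit Types U W : vectType k.

Definition flip U W : 'Hom(U \ox W, W \ox U) := tlift (fun u w => w \oxv u).

Lemma flipE U W (u : U) (w : W) : flip U W (u \oxv w) = w \oxv u.
Proof. by rewrite /flip tlift_tensv //; lin_tac. Qed.

Lemma flipK U W : flip W U \o flip U W = \1.
Proof. by apply: tens_ext => u w; rewrite comp_lfunE !flipE id_lfunE. Qed.

End Flip.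

Section CoOpposite.
Variables (G : groupType) (k : fieldType) (H : hopfGcoalg G k) (g : pivot H).
Implicit Types (x y z : G).

Definition cop_delta x y : 'Hom(H (y * x)%g, H x \ox H y) := flip _ _ \o hdelta y x.

Lemma hdeltaE x y (a : H (x * y)%g) : hdelta x y a = sw (fun u v => u \oxv v) a.
Proof. by rewrite [LHS]tens_tlift /sw /codelta comp_lfunE degcastxx. Qed.

Lemma cop_deltaE x y (a : H (y * x)%g) :
  cop_delta x y a = sw (fun (u : H y) (v : H x) => v \oxv u) a.
Proof.
rewrite comp_lfunE hdeltaE (sw_lin (F := flip _ _)); last by lin_tac.
by apply: eq_sw => u v; rewrite flipE.
Qed.

Lemma sw_hcast (Z : vectType k) x y z r (e : r = z) (b : H x -> H y -> Z) (a : H r) :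
  sw b (hcast H e a) = sw b a.
Proof. by case: z / e; rewrite /= id_lfunE. Qed.

Lemma cop_deltaM x y (a b : H (y * x)%g) : cop_delta x y (hm a b) =
  (hmul x \oxf hmul y) (tswap _ _ _ _ (cop_delta x y a \oxv cop_delta x y b)).
Proof.
rewrite !cop_deltaE sw_mul //; last by lin_tac.
rewrite (sw_lin (F := fun q => (hmul x \oxf hmul y) (tswap _ _ _ _ (q \oxv _))));
  last by lin_tac.
apply: eq_sw => u v.
rewrite (sw_lin (F := fun q => (hmul x \oxf hmul y) (tswap _ _ _ _ (_ \oxv q))));
  last by lin_tac.
by apply: eq_sw => u' v'; rewrite tswapE tmapE.
Qed.

Lemma cop_delta1 x y : cop_delta x y (hone (y * x)%g) = hone x \oxv hone y.
Proof. by rewrite cop_deltaE sw_one //; lin_tac. Qed.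

Lemma cop_coA x y z (e : (z * (y * x) = (z * y) * x)%g) :
  tassoc _ _ _ \o (cop_delta x y \oxf \1) \o cop_delta (y * x)%g z =
  (\1 \oxf cop_delta y z) \o cop_delta x (z * y)%g \o hcast H e.
Proof.
apply/lfunP => h; rewrite !comp_lfunE -!(comp_lfunE (flip _ _)) -!/(cop_delta _ _).
rewrite !cop_deltaE sw_hcast.
rewrite (sw_lin (F := fun q => tassoc _ _ _ ((cop_delta x y \oxf \1) q))); last by lin_tac.
rewrite (sw_lin (F := fun q => (\1 \oxf cop_delta y z) q)); last by lin_tac.
transitivity (sw (fun (c : H z) (u : H (y * x)%g) =>
   sw (fun (b : H y) (a : H x) => a \oxv (b \oxv c)) u) h).
  apply: eq_sw => c u; rewrite tmapE id_lfunE cop_deltaE.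
  rewrite (sw_lin (F := fun q => tassoc _ _ _ (q \oxv c))); last by lin_tac.
  by apply: eq_sw => b a; rewrite tassocE.
rewrite -(sw_coA (s := (z * y)%g)) //; try by lin_tac.
apply: eq_sw => u a; rewrite tmapE id_lfunE cop_deltaE.
by rewrite (sw_lin (F := fun q => a \oxv q)) //; lin_tac.
Qed.

Lemma cop_counitr x (e : (1 * x = x)%g) :
  trunit _ \o (\1 \oxf heps) \o cop_delta x 1%g = hcast H e.
Proof.
apply/lfunP => h; rewrite comp_lfunE comp_lfunE cop_deltaE.
rewrite (sw_lin (F := fun q => trunit _ ((\1 \oxf heps) q))); last by lin_tac.
rewrite -[RHS](sw_counitl (F := fun q => q)) // sw_hcast.
by apply: eq_sw => u v; rewrite tmapE id_lfunE trunitE.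
Qed.

Lemma cop_counitl x (e : (x * 1 = x)%g) :
  tlunit _ \o (heps \oxf \1) \o cop_delta 1%g x = hcast H e.
Proof.
apply/lfunP => h; rewrite comp_lfunE comp_lfunE cop_deltaE.
rewrite (sw_lin (F := fun q => tlunit _ ((heps \oxf \1) q))); last by lin_tac.
rewrite -[RHS](sw_counitr (F := fun q => q)) // sw_hcast.
by apply: eq_sw => u v; rewrite tmapE id_lfunE tlunitE.
Qed.

Lemma hcast_antipV x y z (e : y = z) (a : H x) : hcast H e (antipV g x y a) = antipV g x z a.
Proof. by case: z / e; rewrite /= id_lfunE. Qed.

Lemma cop_Sl x (h : H 1%g) (e1 : x^-1^-1%g = x) (e2 : 1%g = (x * x^-1)%g) :
  hmul x (((hcast H e1 \o antipV g x^-1%g x^-1^-1%g) \oxf \1)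
    (cop_delta x^-1%g x (hcast H e2 h))) = (heps h : k) *: @hone G k H x.
Proof.
rewrite cop_deltaE sw_hcast (sw_lin (F := fun q => hmul x ((_ \oxf \1) q))); last by lin_tac.
rewrite -(sw_antipVl (F := fun q : H x => q) g h (erefl x^-1%g)) //.
by apply: eq_sw => u v; rewrite tmapE comp_lfunE hcast_antipV id_lfunE.
Qed.

Lemma cop_Sr x (h : H 1%g) (e1 : x^-1^-1%g = x) (e2 : 1%g = (x^-1 * x)%g) :
  hmul x ((\1 \oxf (hcast H e1 \o antipV g x^-1%g x^-1^-1%g))
    (cop_delta x x^-1%g (hcast H e2 h))) = (heps h : k) *: @hone G k H x.
Proof.
rewrite cop_deltaE sw_hcast (sw_lin (F := fun q => hmul x ((\1 \oxf _) q))); last by lin_tac.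
rewrite -(sw_antipVr (F := fun q : H x => q) g h (erefl x^-1%g)) //.
by apply: eq_sw => u v; rewrite tmapE comp_lfunE hcast_antipV id_lfunE.
Qed.

(** The equality proofs are left generic in the lemmas above, since those coming
    from the opposite group are different terms. *)
Definition cop : hopfGcoalg (opgroup G) k :=
  @HopfGCoalg (opgroup G) k H (fun x => hmul x) (fun x => hone x)
    (fun x y => cop_delta x y) heps (fun x => antipV g x x^-1%g)
    (fun x => @hmulA G k H x) (fun x => @hmul1l G k H x) (fun x => @hmul1r G k H x)
    cop_deltaM cop_delta1 (@hepsM G k H) (@heps1 G k H)
    (fun x y z => cop_coA _) (fun x => cop_counitr _) (fun x => cop_counitl _)
    (fun x h => cop_Sl h _ _) (fun x h => cop_Sr h _ _).

Lemma pivV_delta x y : cop_delta x y (pivV g (y * x)%g) = pivV g x \oxv pivV g y.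
Proof.
have e (z : G) : z = z^-1^-1%g by rewrite invgK.
rewrite cop_deltaE -(antip_piv g (e (y * x)%g)).
rewrite (antipD (x := x^-1%g) (y := y^-1%g)) ?invgK ?invgM //; last by lin_tac.
rewrite -invgM sw_piv ?invgM //; last by lin_tac.
by rewrite !antip_piv ?invgK.
Qed.

Lemma pivV_eps : heps (pivV g 1%g) = 1.
Proof.
have e : 1%g = 1^-1%g :> G by rewrite invg1.
by rewrite -(antip_piv g e) eps_antip piv_eps.
Qed.

Lemma pivV_SS x (a : H x) (e : x^-1^-1%g = x) :
  hcast H e (antipV g x^-1%g x^-1^-1%g (antipV g x x^-1%g a)) = hm (hm (pivV g x) a) (piv g x).
Proof.
rewrite hcast_antipV antipVE !antipM ?invgK // antipKV // antip_piv ?invgK // antip_pivV ?invgK //.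
by rewrite hmA.
Qed.

Definition cop_piv : pivot cop :=
  @Pivot (opgroup G) k cop (pivV g) (piv g) (piv_Vmul g) (piv_mulV g) pivV_delta pivV_eps
    (fun x a => pivV_SS a _).

Definition cop_gl (nu : grouplike H) : grouplike cop :=
  @Grouplike (opgroup G) k cop nu (@gl_mul _ _ _ nu) (@gl_one _ _ _ nu).

Lemma cop_modulus (alpha : grouplike H) : is_modulus alpha -> is_modulus (cop_gl alpha).
Proof. by []. Qed.

Lemma cop_sw (Z : vectType k) x y z (b : H x -> H y -> Z) (a : H z) : bilin b ->
  @sw (opgroup G) k cop Z x y z b a = sw (fun v u => b u v) a.
Proof.
move=> hb; rewrite [LHS]/sw /codelta comp_lfunE.
rewrite -[hdelta (x : opgroup G) y _]/(cop_delta x y (degcast H z (y * x)%g a)) cop_deltaE.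
rewrite (sw_lin (F := tlift b)); last by lin_tac.
rewrite /sw /codelta !comp_lfunE degcastxx; apply: eq_tlift => v u.
by rewrite tlift_tensv.
Qed.

Lemma cop_Rtw (nu : grouplike H) x : @Rtw (opgroup G) k cop (cop_gl nu) x = Ltw nu x.
Proof.
by apply/lfunP => a; rewrite RtwE cop_sw -?LtwE //; lin_tac.
Qed.

End CoOpposite.

(** * Modules over the co-opposite coalgebra *)

Section CopModules.
Variables (G : groupType) (k : fieldType) (H : hopfGcoalg G k) (g : pivot H).
Notation Hc := (cop g).

Definition to_cop (V : gmod H) : gmod Hc :=
  @GMod (opgroup G) k Hc V (gact V) (gsupp V) (@gactM _ _ _ V) (@gact_orth _ _ _ V)
    (gsupp_uniq V) (gact1 V).

Definition of_cop (V : gmod Hc) : gmod H :=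
  @GMod G k H V (gact V) (gsupp V) (@gactM _ _ _ V) (@gact_orth _ _ _ V)
    (gsupp_uniq V) (gact1 V).

Lemma of_cop_projective (P : gmod Hc) : projective P -> projective (of_cop P).
Proof. by move=> hP M N e f he eonto hf; apply: (hP (to_cop M) (to_cop N)). Qed.

Lemma to_cop_projective (P : gmod H) : projective P -> projective (to_cop P).
Proof. by move=> hP M N e f he eonto hf; apply: (hP (of_cop M) (of_cop N)). Qed.

Lemma flip_hom (P V : gmod H) :
  gmod_hom (flip V P : 'Hom(gtens V P, of_cop (gtens (to_cop P) (to_cop V)))).
Proof.
move=> z h; apply: homog_tens_ext => x y v p hv hp.
rewrite comp_lfunE [RHS]comp_lfunE flipE.
have hvp := homog_tens erefl hv hp.
have hpv := @homog_tens (opgroup G) k Hc (to_cop P) (to_cop V) y x (x * y)%g p v erefl hp hv.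
have [ez|nz] := eqVneq z (x * y)%g; last first.
  rewrite (gact_homog0 _ hvp nz) linear0; symmetry.
  exact: (@gact_homog0 (opgroup G) k Hc (gtens (to_cop P) (to_cop V)) _ _ h _ hpv nz).
rewrite (gtensEl _ _ ez hv) (sw_lin (F := flip V P)); last by lin_tac.
transitivity (@sw (opgroup G) k Hc (P \ox V) y x z
  (fun a b => gact P y a p \oxv gact V x b v) h).
  rewrite cop_sw; last by lin_tac.
  by apply: eq_sw => a b; rewrite flipE.
symmetry; exact: (@gtensEl (opgroup G) k Hc (to_cop P) (to_cop V) y x z h p v ez hp).
Qed.

Lemma flipV_hom (P V : gmod H) :
  gmod_hom (flip P V : 'Hom(of_cop (gtens (to_cop P) (to_cop V)), gtens V P)).
Proof.
move=> z h.
have E : flip P V \o (flip V P \o gact (gtens V P) z h) \o flip P V =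
    gact (gtens V P) z h \o flip P V.
  by rewrite comp_lfunA flipK comp_lfun1l.
rewrite -[RHS]E (@flip_hom P V z h) -!comp_lfunA flipK comp_lfun1r.
by [].
Qed.

Lemma twistLE (nu : grouplike H) (P : gmod H) x (a : H x) :
  gact (twist (Lendo nu) P) x a = gact P x (Ltw nu x a).
Proof. by rewrite /= /twist_act comp_lfunE. Qed.

Lemma cop_twist_hom (nu : grouplike H) (P P' : gmod H) (f : 'Hom(P', P)) :
  gmod_hom (f : 'Hom(to_cop P', twist (Rendo (cop_gl g nu)) (to_cop P))) <->
  gmod_hom (f : 'Hom(P', twist (Lendo nu) P)).
Proof.
have E x (a : H x) : gact (twist (Rendo (cop_gl g nu)) (to_cop P)) x a =
    gact (twist (Lendo nu) P) x a by rewrite twistE cop_Rtw twistLE.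
by split=> hf x a; have := hf x a; rewrite E.
Qed.

Lemma cop_piv_act (V : gmod H) : piv_act (cop_piv g) (to_cop V) = pivV_act g V.
Proof. by []. Qed.

Lemma lptraceE (V : gmod H) (P Q : vectType k) (F : 'Hom(V \ox P, V \ox Q)) :
  lptrace g F = ptrace (flip V Q \o F \o (pivV_act g V \oxf \1) \o flip P V).
Proof.
apply/lfunP => p; rewrite /ptrace sum_lfunE /lptrace.
have lunV : tlunitV P p = (1 : k^o) \oxv p by rewrite /tlunitV linE //; lin_tac.
have coevtE : coevt g V (1 : k^o) =
    \sum_(i < \dim {:V}) (bcoord i : dualv V) \oxv pivV_act g V (vbasis {:V})`_i.
  by rewrite /coevt linE ?scale1r //; lin_tac.
have evE (xi : dualv V) v : ev V (xi \oxv v) = fun_of_lfun xi v.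
  by rewrite /ev tlift_tensv //; lin_tac.
rewrite (comp_lfunE _ (tlunitV P)) lunV (comp_lfunE _ (_ \oxf _)) tmapE id_lfunE coevtE.
rewrite (lin_bigsum (f := fun q => fun_of_lfun _ (q \oxv p))); last by lin_tac.
apply: eq_bigr => i _; rewrite comp_lfunE tassocE !comp_lfunE tmapE id_lfunE tensrE.
rewrite flipE tmapE id_lfunE.
move: (F _) => t; rewrite [t in LHS](tens_tlift t) [t in RHS](tens_tlift t).
rewrite (lin_tlift (F := fun t => tlunit Q ((ev V \oxf \1) (tassocV _ _ _ (_ \oxv t)))));
  last by lin_tac.
rewrite (lin_tlift (F := fun t => trunit Q ((\1 \oxf bcoord i) (flip V Q t)))); last by lin_tac.
apply: eq_tlift => v q; rewrite tassocVE flipE !tmapE !id_lfunE evE trunitE tlunitE.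
by [].
Qed.

(** The left partial trace applies the pivot of the co-opposite coalgebra before f,
    the right one after f; they agree by [ptrace_cyc]. *)
Lemma lptrace_flip (V P Q : gmod H) (f : 'Hom(P \ox V, Q \ox V)) :
  lptrace g (flip Q V \o f \o flip V P) = rptrace (cop_piv g) (V := to_cop V) f.
Proof.
rewrite rptraceE lptraceE cop_piv_act ptrace_cyc; congr ptrace.
rewrite !comp_lfunA flipK comp_lfun1l -!comp_lfunA; congr (_ \o _).
by apply: tens_ext => p v; rewrite !comp_lfunE flipE !tmapE !id_lfunE flipE.
Qed.

End CopModules.

(** * Left module traces *)

Section LeftTrace.
Variables (G : groupType) (k : fieldType) (H : hopfGcoalg G k) (g : pivot H).
Variables (alpha nu : grouplike H).
Hypothesis halpha : is_modulus alpha.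
Notation nuc := (cop_gl g nu).

(** Through the co-opposite coalgebra, where V is the second factor. *)
Lemma tens_projectivel (V P : gmod H) : projective P -> projective (gtens V P).
Proof.
have [c [c0 c_left _]] := halpha => hP.
have hPV := tens_projective (cop_piv g) c0 c_left (V := to_cop g V) (to_cop_projective (g := g) hP).
apply: (retract_projective (flip_hom g P V) (flipV_hom g P V)); first exact: flipK.
exact: of_cop_projective.
Qed.

Definition tr_cop (t : trace_family (Lendo nu)) : trace_family (Rendo nuc) :=
  fun P f => t (of_cop P) f.

Definition tr_uncop (t : trace_family (Rendo nuc)) : trace_family (Lendo nu) :=
  fun P f => t (to_cop g P) f.

Lemma tr_uncop_left (t : trace_family (Rendo nuc)) :
  right_module_trace (cop_piv g) t -> left_module_trace g (tr_uncop t).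
Proof.
case=> t_lin t_cyc t_tens; split.
- move=> P d f f' hP hf hf'; apply: t_lin; first exact: to_cop_projective.
    exact/cop_twist_hom.
  exact/cop_twist_hom.
- move=> P P' h f hP hP' hh hf.
  apply: (t_cyc (to_cop g P) (to_cop g P') h f) => //; try exact: to_cop_projective.
  exact/cop_twist_hom.
move=> V P f hP hf; rewrite /tr_uncop.
have hP' : projective (to_cop g P) by apply: to_cop_projective.
pose f' : 'Hom(P \ox V, P \ox V) := flip V P \o f \o flip P V.
have ff' : flip P V \o f' \o flip V P = f.
  by rewrite /f' !comp_lfunA flipK comp_lfun1l -comp_lfunA flipK comp_lfun1r.
rewrite -{2}ff' lptrace_flip.
pose VP := gtens V P; pose PV := gtens (to_cop g P) (to_cop g V).
have pVP : projective VP by apply: tens_projectivel.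
have pPV : projective PV.
  by have [c [c0 c_left _]] := halpha; apply: (tens_projective (cop_piv g) c0 c_left).
have hfl : gmod_hom (f \o flip P V : 'Hom(of_cop PV, twist (Lendo nu) VP)).
  exact: gmod_hom_comp hf (@flipV_hom _ _ _ g P V).
have hfl' : gmod_hom (f \o flip P V : 'Hom(PV, twist (Rendo nuc) (to_cop g VP))).
  exact: (proj2 (@cop_twist_hom _ _ _ g nu VP (of_cop PV) _) hfl).
have hf' : gmod_hom (f' : 'Hom(PV, twist (Rendo nuc) PV)).
  rewrite /f' -comp_lfunA; apply: gmod_hom_comp hfl'; apply: twist_hom.
  exact: (@flip_hom _ _ _ g P V).
rewrite -(t_tens (to_cop g P) (to_cop g V) f' hP' hf').
have := t_cyc (to_cop g VP) PV (flip V P) (f \o flip P V) (to_cop_projective (g := g) pVP) pPV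
  (@flip_hom _ _ _ g P V) hfl'.
by rewrite /f' -[X in X = _ -> _]/(t _ _) -!comp_lfunA flipK comp_lfun1r.
Qed.

Lemma tr_cop_right (t : trace_family (Lendo nu)) :
  left_module_trace g t -> right_module_trace (cop_piv g) (tr_cop t).
Proof.
have hom_of (P P' : gmod (cop g)) (f : 'Hom(P', P)) :
    gmod_hom (f : 'Hom(P', twist (Rendo nuc) P)) ->
    gmod_hom (f : 'Hom(of_cop P', twist (Lendo nu) (of_cop P))).
  move=> hf; apply/(@cop_twist_hom _ _ _ g nu (of_cop P) (of_cop P')).
  by case: P P' f hf => ? ? ? ? ? ? ? [].
case=> t_lin t_cyc t_tens; split.
- move=> P d f f' hP hf hf'; apply: t_lin; first exact: of_cop_projective.
    exact: hom_of.
  exact: hom_of.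
- move=> P P' h f hP hP' hh hf.
  apply: (t_cyc (of_cop P) (of_cop P') h f) => //; try exact: of_cop_projective.
  exact: hom_of.
(* a module equals its round trip only up to the expansion of the record *)
suff tens (P V : gmod H) (f : 'Hom(P \ox V, P \ox V)) : projective (to_cop g P) ->
    gmod_hom (f : 'Hom(gtens (to_cop g P) (to_cop g V),
      twist (Rendo nuc) (gtens (to_cop g P) (to_cop g V)))) ->
    t (of_cop (gtens (to_cop g P) (to_cop g V))) f =
    t (of_cop (to_cop g P)) (rptrace (cop_piv g) (V := to_cop g V) f).
  by move=> [P1 P2 P3 P4 P5 P6 P7] [V1 V2 V3 V4 V5 V6 V7]; exact: (tens (of_cop _) (of_cop _)).
move=> hP' hf'.
have hP : projective P by case: P hP' {f hf'} => ? ? ? ? ? ? ?; exact: of_cop_projective.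
pose VP := gtens V P; pose PV := gtens (to_cop g P) (to_cop g V).
have pVP : projective VP by apply: tens_projectivel.
have pPV : projective (of_cop PV).
  have [c [c0 c_left _]] := halpha; apply: of_cop_projective.
  exact: (tens_projective (cop_piv g) c0 c_left).
have hfl : gmod_hom (flip P V \o f : 'Hom(of_cop PV, twist (Lendo nu) VP)).
  apply: gmod_hom_comp (hom_of _ _ _ hf').
  by apply: twist_hom; apply: (@flipV_hom _ _ _ g P V).
have := t_cyc VP (of_cop PV) (flip V P) (flip P V \o f) pVP pPV (@flip_hom _ _ _ g P V) hfl.
rewrite comp_lfunA flipK comp_lfun1l => <-.
have tE X : t (of_cop (to_cop g P)) X = t P X by case: P X {f hP' hf' hP VP PV pVP pPV hfl}.
rewrite tE -lptrace_flip (t_tens V P) //.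
exact: gmod_hom_comp hfl (@flip_hom _ _ _ g P V).
Qed.

Lemma tr_copE (t : trace_family (Lendo nu)) P f : tr_cop t (P := to_cop g P) f = t P f.
Proof. by case: P f. Qed.

Lemma tr_cop_nonzero (t : trace_family (Lendo nu)) : trace_nonzero t ->
  trace_nonzero (tr_cop t).
Proof.
case=> P [f [hP hf tf]]; exists (to_cop g P), f; split.
- exact: to_cop_projective.
- exact/cop_twist_hom.
- by rewrite tr_copE.
Qed.

Lemma left_trace_modulus (t : trace_family (Lendo nu)) :
  left_module_trace g t -> trace_nonzero t -> gl_fun nu = gl_fun alpha.
Proof.
move=> tl tn.
exact: (right_trace_modulus (cop_modulus g halpha) (tr_cop_right tl) (tr_cop_nonzero tn)).
Qed.

Lemma left_trace_exists : gl_fun nu = gl_fun alpha ->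
  exists t : trace_family (Lendo nu), left_module_trace g t /\ trace_nonzero t.
Proof.
move=> enu; have [t [tr [P [f [hP hf tf]]]]] :=
  right_trace_exists (cop_piv g) (nu := nuc) (cop_modulus g halpha) enu.
exists (tr_uncop t); split; first exact: tr_uncop_left.
exists (of_cop P), f; split; first exact: of_cop_projective.
  by apply/(@cop_twist_hom _ _ _ g nu (of_cop P) (of_cop P)); case: P f hf {hP tf}.
by rewrite /tr_uncop; case: P f tf {hP hf}.
Qed.

Lemma left_trace_nondegenerate (t : trace_family (Lendo nu)) :
  left_module_trace g t -> trace_nonzero t -> trace_nondegenerate t.
Proof.
move=> tl tn P P' hP hP'.
have [nd1 nd2] := right_trace_nondegenerate (cop_modulus g halpha) (tr_cop_right tl)
  (tr_cop_nonzero tn) (to_cop_projective (g := g) hP) (to_cop_projective (g := g) hP').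
split=> [f hf f0 | h hh h0].
  apply: nd1 => [|h hh]; first exact/cop_twist_hom.
  by rewrite tr_copE; apply: f0.
apply: nd2 => // f hf; rewrite tr_copE; apply: h0.
exact: (proj1 (@cop_twist_hom _ _ _ g nu P P' f) hf).
Qed.

End LeftTrace.

(** * Untwisted traces and unimodularity *)

Section Modified.
Variables (G : groupType) (k : fieldType) (H : hopfGcoalg G k) (g : pivot H).

(** The counit as a group-like functional; its twists are the identity, so that
    modified traces are module traces for it. *)
Definition eps_gl : grouplike H := @Grouplike G k H heps (@hepsM G k H) (@heps1 G k H).

Lemma Rtw_eps x (a : H x) : Rtw eps_gl x a = a.
Proof. by rewrite RtwE (sw_counitl (F := fun q => q)). Qed.

Lemma Ltw_eps x (a : H x) : Ltw eps_gl x a = a.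
Proof. by rewrite LtwE (sw_counitr (F := fun q => q)). Qed.

Lemma twist_eq_hom (phi psi : algendo H) (P P' : gmod H) (f : 'Hom(P', P)) :
  (forall x (a : H x), phi x a = psi x a) ->
  gmod_hom (f : 'Hom(P', twist phi P)) -> gmod_hom (f : 'Hom(P', twist psi P)).
Proof.
move=> E hf x a; have := hf x a.
by rewrite /= /twist_act !(comp_lfunE (gact P x)) E.
Qed.

Section SameTwist.
Variables phi psi : algendo H.
Hypothesis phi_psi : forall x (a : H x), phi x a = psi x a.
Let psi_phi x (a : H x) : psi x a = phi x a := esym (phi_psi a).

Lemma twist_eq_nonzero (t : trace_family phi) :
  trace_nonzero t -> trace_nonzero (t : trace_family psi).
Proof.
by case=> P [f [hP hf tf]]; exists P, f; split=> //; apply: twist_eq_hom hf.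
Qed.

Lemma twist_eq_right (t : trace_family phi) :
  right_module_trace g t -> right_module_trace g (t : trace_family psi).
Proof.
case=> t_lin t_cyc t_tens; split.
- by move=> P d f f' hP hf hf'; apply: t_lin => //; apply: (twist_eq_hom psi_phi).
- by move=> P P' h f hP hP' hh hf; apply: t_cyc => //; apply: (twist_eq_hom psi_phi).
move=> P V f hP hf; apply: t_tens => //.
exact: (twist_eq_hom (P := gtens P V) (P' := gtens P V) psi_phi hf).
Qed.

Lemma twist_eq_left (t : trace_family phi) :
  left_module_trace g t -> left_module_trace g (t : trace_family psi).
Proof.
case=> t_lin t_cyc t_tens; split.
- by move=> P d f f' hP hf hf'; apply: t_lin => //; apply: (twist_eq_hom psi_phi).
- by move=> P P' h f hP hP' hh hf; apply: t_cyc => //; apply: (twist_eq_hom psi_phi).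
move=> V P f hP hf; apply: t_tens => //.
exact: (twist_eq_hom (P := gtens V P) (P' := gtens V P) psi_phi hf).
Qed.

End SameTwist.

Lemma modulus_uniq (alpha beta : grouplike H) :
  is_modulus alpha -> is_modulus beta -> gl_fun alpha = gl_fun beta.
Proof.
move=> [c [c0 c_left ca]] [d [d0 hd da]]; have [kappa dk] := cointegral_uniq g c0 c_left hd.
apply/lfunP => a; apply/eqP; rewrite -subr_eq0; apply: contraNT d0 => ab.
have : ((alpha a : k) - beta a) *: d = 0.
  rewrite scalerBl -da {2}dk (bilinZl _ _ _ (@hm_bilin _ _ _ _)) ca scalerA mulrC -scalerA -dk.
  exact: subrr.
by move/eqP; rewrite scaler_eq0 (negPf ab).
Qed.

End Modified.

Theorem corollary5p7 (G : groupType) (k : fieldType) (H : hopfGcoalg G k)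
    (g : pivot H) (alpha : grouplike H) (halpha : is_modulus alpha) :
  (forall nu : grouplike H,
    [/\ (exists t : trace_family (Rendo nu),
           right_module_trace g t /\ trace_nonzero t) <->
          gl_fun nu = gl_fun alpha,
        (exists t : trace_family (Lendo nu),
           left_module_trace g t /\ trace_nonzero t) <->
          gl_fun nu = gl_fun alpha,
        forall t : trace_family (Rendo nu),
          right_module_trace g t -> trace_nonzero t -> trace_nondegenerate t &
        forall t : trace_family (Lendo nu),
          left_module_trace g t -> trace_nonzero t -> trace_nondegenerate t]) /\
  ((exists t : trace_family (id_algendo H),
      right_modified_trace g t /\ trace_nonzero t) <-> unimodular H) /\
  ((exists t : trace_family (id_algendo H),
      left_modified_trace g t /\ trace_nonzero t) <-> unimodular H).
Proof.
have right_iff nu : (exists t : trace_family (Rendo nu),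
    right_module_trace g t /\ trace_nonzero t) <-> gl_fun nu = gl_fun alpha.
  by split=> [[t [tr tn]]|]; [exact: right_trace_modulus tr tn | exact: right_trace_exists].
have left_iff nu : (exists t : trace_family (Lendo nu),
    left_module_trace g t /\ trace_nonzero t) <-> gl_fun nu = gl_fun alpha.
  by split=> [[t [tl tn]]|]; [exact: left_trace_modulus tl tn | exact: left_trace_exists].
have unimod : unimodular H <-> gl_fun (eps_gl H) = gl_fun alpha.
  split=> [[beta hbeta e]|e]; first by rewrite -(modulus_uniq g hbeta halpha) e.
  by exists alpha.
have idR x (a : H x) : id_algendo H x a = Rendo (eps_gl H) x a by rewrite id_lfunE Rtw_eps.
have idL x (a : H x) : id_algendo H x a = Lendo (eps_gl H) x a by rewrite id_lfunE Ltw_eps.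
split.
  move=> nu; split; [exact: right_iff | exact: left_iff | |] => t.
    exact: (right_trace_nondegenerate halpha).
  exact: (left_trace_nondegenerate halpha).
split.
  apply: iff_trans (iff_sym unimod); apply: iff_trans (right_iff _); split=> -[t [tr tn]]; exists t.
    by split; [exact: twist_eq_right idR _ tr | exact: twist_eq_nonzero idR _ tn].
  split; [exact: twist_eq_right (fun x a => esym (idR x a)) _ tr |].
  exact: twist_eq_nonzero (fun x a => esym (idR x a)) _ tn.
apply: iff_trans (iff_sym unimod); apply: iff_trans (left_iff _); split=> -[t [tl tn]]; exists t.
  by split; [exact: twist_eq_left idL _ tl | exact: twist_eq_nonzero idL _ tn].
split; [exact: twist_eq_left (fun x a => esym (idL x a)) _ tl |].
exact: twist_eq_nonzero (fun x a => esym (idL x a)) _ tn.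
Qed.
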